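(* Let $L$ be an algebraic language with term category $\mathbf{L}$ and generic $L$-structure $G$ in $\mathbf{L}$. For every monoidal category $\mathbf{C}$, the functor $\hom(\mathbf{L},\mathbf{C})\to\mathrm{Str}(L,\mathbf{C})$ given by evaluation at $G$ (sending a strong monoidal functor $F$ to the induced $L$-structure $FG$) is an equivalence of categories; thus $\mathbf{L}$ is a classifying category for $L$-structures.
   Context: Algebraic languages: fix a finitary many-sorted signature $\Sigma$ (atomic types; functional constants $f\colon B_1,\dots,B_n\to B_{n+1}$). Types are finite sequences of atomic types (juxtaposition; $\emptyset$ empty). Raw terms: $t::=\emptyset\mid x\mid f(t_1,\dots,t_n)\mid tt$, tensor associative with unit $\emptyset$; $t[s/x]$ denotes simultaneous substitution of $s=s_1\dots s_n$ for distinct atomic variables $x=x_1\dots x_n$. Sequents $x:A\vdash t:B$ with $x$ distinct atomic variables. Term calculus: Variables $x:A\vdash x:A$ ($x,A$ atomic); Functions: from $x_i:A_i\vdash t_i:B_i$ infer $x_1\dots x_n:A_1\dots A_n\vdash f(t_1,\dots,t_n):B_{n+1}$; Substitution: from $x:A\vdash s:B$, $y:B\vdash t:C$ infer $x:A\vdash t[s/y]:C$; Unit $\emptyset:\emptyset\vdash\emptyset:\emptyset$; Tensor: from $x:A\vdash s:B$, $y:C\vdash t:D$ infer $xy:AC\vdash st:BD$; Weakening: from $x_1x_3:A_1A_3\vdash t:B$ infer $x_1x_2x_3:A_1A_2A_3\vdash t:B$; Exchange: from $x:A\vdash t:B$ infer $\sigma x:\sigma A\vdash t:B$; Contraction: from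 $x_1xx'x_2:A_1AAA_2\vdash t:B$ infer $x_1xx_2:A_1AA_2\vdash t[x/x']:B$. An algebraic language $L$ is $\Sigma$ plus a subset of {weakening, exchange, contraction}; its terms are the sequents derivable with all non-structural rules and its structural rules. Structures: in a monoidal category $\mathbf{C}$ (coherence isomorphisms inserted where needed), an $L$-prestructure assigns objects $|A|$ to atomic types (extended to types by tensor, $|\emptyset|=1$), arrows $|f|\colon|B_1|\dots|B_n|\to|B_{n+1}|$, and for the structural rules of $L$ arrows $\pi_A\colon|A|\to1$, $\sigma_A\colon|\sigma A|\to|A|$, $\Delta_A\colon|A|\to|AA|$ for all types $A$. Derivations are interpreted inductively (variables $\mapsto$ identities, functions $\mapsto$ tensor of interpretations followed by $|f|$, substitution $\mapsto$ composition, unit $\mapsto$ identity of 1, tensor $\mapsto$ tensor, weakening/exchange/contraction $\mapsto$ precomposition with $1\pi_A1$, $\sigma_A$, $1\Delta_A1$). An $L$-structure is a prestructure whose interpretation of terms is independent of derivations. A morphism $h\colon M\to N$ consists of arrows $h_A\colon|A|_M\to|A|_N$ ($A$ atomic, extended by tensor) with $h_A\cdot|t|_N=|t|_M\cdot h_B$ for every term $x:A\vdash t:B$ (composition written diagrammatically). $\mathrm{Str}(L,\mathbf{C})$ is the resulting category. A strong monoidal functor $F\colon\mathbf{L}\to\mathbf{C}$ transports an $L$-structure $M$ to $FM$ by applying $F$ and correcting domains/codomains with the coherence isomorphisms of $F$; a monoidal natural transformation $k\colon F\to F'$ gives the morphism with components $k_{|A|_M}$. $\hom(\mathbf{L},\mathbf{C})$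 is the category of strong monoidal functors and monoidal natural transformations. Term category: terms $x:A\vdash s:B$ and $y:A\vdash t:B$ are alphabetical variants if $s[z/x]=t[z/y]$ for some variable $z:A$. $\mathbf{L}$ has types as objects, terms modulo alphabetical variance as arrows, composition of $x:A\vdash s:B$ and $y:B\vdash t:C$ given by $x:A\vdash t[s/y]:C$, identities $x:A\vdash x:A$, and strict monoidal tensor given by concatenation of types and the tensor of terms. The generic $L$-structure $G$ in $\mathbf{L}$: $|A|=A$, $|f|=(x_1\dots x_n:B_1\dots B_n\vdash f(x_1,\dots,x_n):B_{n+1})$, $\pi_A=(x:A\vdash\emptyset:\emptyset)$, $\sigma_A=(\sigma x:\sigma A\vdash x:A)$, $\Delta_A=(x:A\vdash xx:AA)$. *)

(* Defs.v *)
From mathcomp Require Import all_boot perm.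
From mathcomp Require Import boolp.

Set Implicit Arguments.
Unset Strict Implicit.
Unset Printing Implicit Defensive.

(* Composition is written diagrammatically: [f >> g] is f followed by g. *)

Record category := Category {
  obj :> Type;
  hom : obj -> obj -> Type;
  idm : forall a, hom a a;
  comp : forall a b c, hom a b -> hom b c -> hom a c;
  comp1m : forall a b (f : hom a b), comp (idm a) f = f;
  compm1 : forall a b (f : hom a b), comp f (idm b) = f;
  compA : forall a b c d (f : hom a b) (g : hom b c) (h : hom c d),
    comp f (comp g h) = comp (comp f g) h }.

Arguments hom {c} _ _ : rename.
Arguments idm {c} a : rename.
Arguments comp {c} [a b c] _ _ : rename.
Arguments comp1m {c} [a b] f : rename.
Arguments compm1 {c} [a b] f : rename.
Arguments compA {c} [a b c d] f g h : rename.

Declare Scope cat_scope.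
Delimit Scope cat_scope with cat.
Local Open Scope cat_scope.

Notation "f >> g" := (comp f g) (at level 45, left associativity) : cat_scope.

Record iso (C : category) (a b : C) := Iso {
  fwd :> hom a b;
  bwd : hom b a;
  fwdK : fwd >> bwd = idm a;
  bwdK : bwd >> fwd = idm b }.

Record functor (C D : category) := Functor {
  fobj :> C -> D;
  fmap : forall a b : C, hom a b -> hom (fobj a) (fobj b);
  fmap1 : forall a, fmap (idm a) = idm (fobj a);
  fmapM : forall a b c (f : hom a b) (g : hom b c),
    fmap (f >> g) = fmap f >> fmap g }.

Arguments fmap {C D} f [a b] _ : rename.

Lemma fid_subproof2 (C : category) (a b c : C) (f : hom a b) (g : hom b c) :
  f >> g = f >> g.
Proof. by []. Qed.

Definition fid (C : category) : functor C C :=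
  @Functor C C (fun a => a) (fun a b f => f) (fun a => erefl)
    (@fid_subproof2 C).

Lemma fcomp_subproof1 (C D E : category) (F : functor C D) (G : functor D E) a :
  fmap G (fmap F (idm a)) = idm (G (F a)).
Proof. by rewrite !fmap1. Qed.

Lemma fcomp_subproof2 (C D E : category) (F : functor C D) (G : functor D E)
    a b c (f : hom a b) (g : hom b c) :
  fmap G (fmap F (f >> g)) = fmap G (fmap F f) >> fmap G (fmap F g).
Proof. by rewrite !fmapM. Qed.

Definition fcomp (C D E : category) (F : functor C D) (G : functor D E) :
    functor C E :=
  Functor (fcomp_subproof1 F G) (fcomp_subproof2 F G).

Definition nat_iso (C D : category) (F G : functor C D) : Prop :=
  exists k : forall a, iso (F a) (G a),
    forall a b (f : hom a b), fmap F f >> k b = k a >> fmap G f.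

Definition is_equivalence (C D : category) (F : functor C D) : Prop :=
  exists G : functor D C,
    nat_iso (fcomp F G) (fid C) /\ nat_iso (fcomp G F) (fid D).

Record monoidal := Monoidal {
  mcat :> category;
  one : mcat;
  tens : mcat -> mcat -> mcat;
  tensm : forall a b c d : mcat,
    hom a b -> hom c d -> hom (tens a c) (tens b d);
  asc : forall a b c, iso (tens (tens a b) c) (tens a (tens b c));
  lun : forall a, iso (tens one a) a;
  run : forall a, iso (tens a one) a;
  tensm1 : forall a b, tensm (idm a) (idm b) = idm (tens a b);
  tensmM : forall a b c a' b' c' (f : hom a b) (g : hom b c)
      (f' : hom a' b') (g' : hom b' c'),
    tensm (f >> g) (f' >> g') = tensm f f' >> tensm g g';
  ascN : forall a a' b b' c c' (f : hom a a') (g : hom b b') (h : hom c c'),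
    tensm (tensm f g) h >> asc a' b' c' = asc a b c >> tensm f (tensm g h);
  lunN : forall a b (f : hom a b), tensm (idm one) f >> lun b = lun a >> f;
  runN : forall a b (f : hom a b), tensm f (idm one) >> run b = run a >> f;
  triangle : forall a b,
    asc a one b >> tensm (idm a) (lun b) = tensm (run a) (idm b);
  pentagon : forall a b c d,
    asc (tens a b) c d >> asc a b (tens c d) =
    tensm (asc a b c) (idm d) >> asc a (tens b c) d
      >> tensm (idm a) (asc b c d) }.

Arguments one {m}.
Arguments tens {m} _ _.
Arguments tensm {m} [a b c d] _ _.
Arguments asc {m} a b c.
Arguments lun {m} a.
Arguments run {m} a.

Notation "a ** b" := (tens a b) (at level 40, left associativity) : cat_scope.
Notation "f *** g" := (tensm f g) (at level 40, left associativity) : cat_scope.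

Record smfunctor (C D : monoidal) := SMFunctor {
  smf :> functor C D;
  phi0 : iso one (smf one);
  phi2 : forall a b, iso (smf a ** smf b) (smf (a ** b));
  phi2N : forall a a' b b' (f : hom a a') (g : hom b b'),
    (fmap smf f *** fmap smf g) >> phi2 a' b' =
    phi2 a b >> fmap smf (f *** g);
  phi2A : forall a b c,
    (phi2 a b *** idm (smf c)) >> phi2 (a ** b) c >> fmap smf (asc a b c) =
    asc (smf a) (smf b) (smf c) >> (idm (smf a) *** phi2 b c)
      >> phi2 a (b ** c);
  phi2l : forall a,
    (phi0 *** idm (smf a)) >> phi2 one a >> fmap smf (lun a) = lun (smf a);
  phi2r : forall a,
    (idm (smf a) *** phi0) >> phi2 a one >> fmap smf (run a) = run (smf a) }.

Arguments phi0 {C D} s : rename.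
Arguments phi2 {C D} s a b : rename.

Record mnat (C D : monoidal) (F G : smfunctor C D) := MNat {
  mcomp :> forall a, hom (F a) (G a);
  mcompN : forall a b (f : hom a b), fmap F f >> mcomp b = mcomp a >> fmap G f;
  mcomp1 : phi0 F >> mcomp one = phi0 G;
  mcompM : forall a b,
    phi2 F a b >> mcomp (a ** b) = (mcomp a *** mcomp b) >> phi2 G a b }.

Lemma mnatP (C D : monoidal) (F G : smfunctor C D) (k l : mnat F G) :
  (forall a, k a = l a) -> k = l.
Proof.
case: k l => [k kN k1 kM] [l lN l1 lM] /= kl.
have e : k = l by apply: functional_extensionality_dep.
by subst l; congr MNat; apply: Prop_irrelevance.
Qed.

Section HomCategory.
Variables C D : monoidal.

Lemma mnat_id_subproofN (F : smfunctor C D) a b (f : hom a b) :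
  fmap F f >> idm (F b) = idm (F a) >> fmap F f.
Proof. by rewrite compm1 comp1m. Qed.

Lemma mnat_id_subproofM (F : smfunctor C D) a b :
  phi2 F a b >> idm (F (a ** b)) = (idm (F a) *** idm (F b)) >> phi2 F a b.
Proof. by rewrite compm1 tensm1 comp1m. Qed.

Definition mnat_id (F : smfunctor C D) : mnat F F :=
  MNat (@mnat_id_subproofN F) (compm1 _) (@mnat_id_subproofM F).

Section Comp.
Variables (F G H : smfunctor C D) (k : mnat F G) (l : mnat G H).

Lemma mnat_comp_subproofN a b (f : hom a b) :
  fmap F f >> (k b >> l b) = (k a >> l a) >> fmap H f.
Proof. by rewrite compA mcompN -!compA mcompN. Qed.

Lemma mnat_comp_subproof1 : phi0 F >> (k one >> l one) = phi0 H.
Proof. by rewrite compA !mcomp1. Qed.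

Lemma mnat_comp_subproofM a b :
  phi2 F a b >> (k (a ** b) >> l (a ** b)) =
  ((k a >> l a) *** (k b >> l b)) >> phi2 H a b.
Proof. by rewrite compA mcompM -compA mcompM compA tensmM. Qed.

Definition mnat_comp : mnat F H :=
  MNat mnat_comp_subproofN mnat_comp_subproof1 mnat_comp_subproofM.
End Comp.

Lemma mnat_comp1m F G (k : mnat F G) : mnat_comp (mnat_id F) k = k.
Proof. by apply: mnatP => a /=; rewrite comp1m. Qed.

Lemma mnat_compm1 F G (k : mnat F G) : mnat_comp k (mnat_id G) = k.
Proof. by apply: mnatP => a /=; rewrite compm1. Qed.

Lemma mnat_compA F G H I (k : mnat F G) (l : mnat G H) (m : mnat H I) :
  mnat_comp k (mnat_comp l m) = mnat_comp (mnat_comp k l) m.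
Proof. by apply: mnatP => a /=; rewrite compA. Qed.

Definition hom_cat : category := Category mnat_comp1m mnat_compm1 mnat_compA.
End HomCategory.

(* Sorts are the atomic types, so that a type is a sequence of sorts. *)
Record signature := Signature {
  sort : Type;
  op : Type;
  dom : op -> seq sort;
  cod : op -> sort }.

Record language := Language {
  sig :> signature;
  has_weak : bool;
  has_exch : bool;
  has_contr : bool }.

(* (sA)_i = A_(s i) *)
Definition permt T n (s : 'S_n) (u : n.-tuple T) : n.-tuple T :=
  [tuple tnth u (s i) | i < n].

Section Terms.
Variable L : language.
Local Notation S := (sort L).

(* Raw terms form the free monoid on the atomic ones: variables (numbered) and
   applications of a functional constant to a list of raw terms. *)
Inductive atom := Var of nat | App of op L & seq (seq atom).
Definition raw := seq atom.

Fixpoint abind (e : nat -> atom) (a : atom) : atom :=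
  match a with
  | Var v => e v
  | App f ts => App f [seq [seq abind e b | b <- t] | t <- ts]
  end.

(* [subst x s t] is t[s/x]: the variable x_i is replaced by the atomic term
   s_i, and the variables outside x are unchanged. *)
Definition env (x : seq nat) (s : raw) (v : nat) : atom :=
  nth (Var v) s (index v x).
Definition subst (x : seq nat) (s t : raw) : raw := [seq abind (env x s) a | a <- t].

Definition vars (x : seq nat) : raw := [seq Var v | v <- x].

(* [deriv x A t B] is the type of derivations of the sequent x:A |- t:B, and
   [derivs xs As ts Bs] that of lists of derivations of x_i:A_i |- t_i:B_i with
   B_i atomic.  The side conditions make x repetition-free and of the same
   length as A in every derivable sequent. *)
Inductive deriv : seq nat -> seq S -> raw -> seq S -> Type :=
| d_var v (B : S) : deriv [:: v] [:: B] [:: Var v] [:: B]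
| d_fun (f : op L) xs As ts :
    uniq (flatten xs) -> derivs xs As ts (dom f) ->
    deriv (flatten xs) (flatten As) [:: App f ts] [:: cod f]
| d_subst x A s y B t C :
    deriv x A s B -> deriv y B t C -> deriv x A (subst y s t) C
| d_unit : deriv [::] [::] [::] [::]
| d_tens x A s B y C t D :
    uniq (x ++ y) -> deriv x A s B -> deriv y C t D ->
    deriv (x ++ y) (A ++ C) (s ++ t) (B ++ D)
| d_weak x1 A1 x2 A2 x3 A3 t B :
    has_weak L -> size x1 = size A1 -> size x2 = size A2 ->
    uniq (x1 ++ x2 ++ x3) ->
    deriv (x1 ++ x3) (A1 ++ A3) t B ->
    deriv (x1 ++ x2 ++ x3) (A1 ++ A2 ++ A3) t B
| d_exch n (s : 'S_n) (x : n.-tuple nat) (A : n.-tuple S) t B :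
    has_exch L -> deriv x A t B -> deriv (permt s x) (permt s A) t B
| d_contr x1 A1 x x' A x2 A2 t B :
    has_contr L -> size x1 = size A1 -> size x = size A -> size x' = size A ->
    deriv (x1 ++ x ++ x' ++ x2) (A1 ++ A ++ A ++ A2) t B ->
    deriv (x1 ++ x ++ x2) (A1 ++ A ++ A2) (subst x' (vars x) t) B
with derivs :
    seq (seq nat) -> seq (seq S) -> seq raw -> seq S -> Type :=
| ds_nil : derivs [::] [::] [::] [::]
| ds_cons x A t (B : S) xs As ts Bs :
    deriv x A t [:: B] -> derivs xs As ts Bs ->
    derivs (x :: xs) (A :: As) (t :: ts) (B :: Bs).

Scheme deriv_mut := Induction for deriv Sort Prop
with derivs_mut := Induction for derivs Sort Prop.
Combined Scheme derivs_mutind from deriv_mut, derivs_mut.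

Definition derivable x A t B : Prop := inhabited (deriv x A t B).

End Terms.

Arguments Var {L} _.
Arguments App {L} _ _.
Arguments vars {L} _.
Arguments deriv {L} _ _ _ _.
Arguments derivable {L} _ _ _ _.
Arguments d_unit {L}.

Definition iso_sym (C : category) (a b : C) (u : iso a b) : iso b a :=
  Iso (bwdK u) (fwdK u).

Definition iso_id (C : category) (a : C) : iso a a :=
  Iso (comp1m (idm a)) (comp1m (idm a)).

Lemma iso_comp_subproof (C : category) (a b c : C) (u : iso a b) (v : iso b c) :
  (u >> v) >> (bwd v >> bwd u) = idm a.
Proof. by rewrite -compA (compA v) fwdK comp1m fwdK. Qed.

Definition iso_comp (C : category) (a b c : C) (u : iso a b) (v : iso b c) :
    iso a c :=
  Iso (iso_comp_subproof u v) (iso_comp_subproof (iso_sym v) (iso_sym u)).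

Lemma iso_tens_subproof (C : monoidal) (a b c d : C)
    (u : iso a b) (v : iso c d) :
  (u *** v) >> (bwd u *** bwd v) = idm (a ** c).
Proof. by rewrite -tensmM !fwdK tensm1. Qed.

Definition iso_tens (C : monoidal) (a b c d : C) (u : iso a b) (v : iso c d) :
    iso (a ** c) (b ** d) :=
  Iso (iso_tens_subproof u v) (iso_tens_subproof (iso_sym u) (iso_sym v)).

Lemma iso_fmap_subproof (C D : category) (F : functor C D) (a b : C)
    (u : iso a b) :
  fmap F u >> fmap F (bwd u) = idm (F a).
Proof. by rewrite -fmapM fwdK fmap1. Qed.

Section Types.
Variables (C : monoidal) (S : Type) (o : S -> C).

Fixpoint tobj (A : seq S) : C := if A is a :: A' then o a ** tobj A' else one.

(* The coherence isomorphism |A||B| -> |AB|. *)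
Fixpoint kap (A B : seq S) : iso (tobj A ** tobj B) (tobj (A ++ B)) :=
  match A return iso (tobj A ** tobj B) (tobj (A ++ B)) with
  | [::] => lun (tobj B)
  | a :: A' => iso_comp (asc (o a) (tobj A') (tobj B))
                 (iso_tens (iso_id (o a)) (kap A' B))
  end.

End Types.

Section Families.
Variables (C : monoidal) (S : Type).

Fixpoint tmor (o o' : S -> C) (h : forall a, hom (o a) (o' a)) (A : seq S) :
    hom (tobj o A) (tobj o' A) :=
  match A with
  | [::] => idm one
  | a :: A' => h a *** tmor h A'
  end.
End Families.

Section Structures.
Variables (L : language) (C : monoidal).
Local Notation S := (sort L).

Record prestructure := PreStructure {
  pobj :> S -> C;
  pop : forall f : op L, hom (tobj pobj (dom f)) (pobj (cod f));
  pweak : has_weak L -> forall A : seq S, hom (tobj pobj A) one;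
  pexch : has_exch L -> forall n (s : 'S_n) (A : n.-tuple S),
    hom (tobj pobj (permt s A)) (tobj pobj A);
  pcontr : has_contr L -> forall A : seq S,
    hom (tobj pobj A) (tobj pobj (A ++ A)) }.

Section Interpretation.
Variable M : prestructure.
Local Notation ob := (tobj M).
Local Notation kap := (kap M).

Definition ktens (A B A' B' : seq S) (f : hom (ob A) (ob B)) (g : hom (ob A') (ob B')) :
    hom (ob (A ++ A')) (ob (B ++ B')) :=
  bwd (kap A A') >> (f *** g) >> kap B B'.

(* The arrow 1 pi_A 1. *)
Definition iweak (w : has_weak L) (A1 A A2 : seq S) :
    hom (ob (A1 ++ A ++ A2)) (ob (A1 ++ A2)) :=
  ktens (idm (ob A1))
    (bwd (kap A A2) >> (pweak M w A *** idm (ob A2)) >> lun (ob A2)).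

(* The arrow 1 Delta_A 1. *)
Definition icontr (w : has_contr L) (A1 A A2 : seq S) :
    hom (ob (A1 ++ A ++ A2)) (ob (A1 ++ A ++ A ++ A2)) :=
  ktens (idm (ob A1))
    (bwd (kap A A2) >> ((pcontr M w A >> bwd (kap A A)) *** idm (ob A2))
       >> asc (ob A) (ob A) (ob A2) >> (idm (ob A) *** kap A A2) >> kap A (A ++ A2)).

(* As |[:: B]| is |B| ** one, the unit isomorphism occurs after [pop]. *)
Fixpoint interp x A t B (d : deriv x A t B) : hom (ob A) (ob B) :=
  match d in deriv _ A _ B return hom (ob A) (ob B) with
  | d_var _ B => idm (ob ([:: B]))
  | d_fun f _ _ _ _ ds => interps ds >> pop M f >> bwd (run (M (cod f)))
  | d_subst _ _ _ _ _ _ _ d1 d2 => interp d1 >> interp d2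
  | d_unit => idm one
  | d_tens _ _ _ _ _ _ _ _ _ d1 d2 => ktens (interp d1) (interp d2)
  | d_weak _ A1 _ A2 _ A3 _ _ w _ _ _ d => iweak w A1 A2 A3 >> interp d
  | d_exch _ s _ A _ _ w d => pexch M w s A >> interp d
  | d_contr _ A1 _ _ A _ A2 _ _ w _ _ _ d => icontr w A1 A A2 >> interp d
  end
with interps xs As ts Bs (ds : derivs xs As ts Bs) :
    hom (ob (flatten As)) (ob Bs) :=
  match ds in derivs _ As _ Bs return hom (ob (flatten As)) (ob Bs) with
  | ds_nil => idm one
  | ds_cons _ _ _ _ _ _ _ _ d ds => ktens (interp d) (interps ds)
  end.

(* Two derivations of the same sequent have the same interpretation. *)
Definition coherent : Prop :=
  forall x A t B (d d' : deriv x A t B), interp d = interp d'.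

End Interpretation.

Record structure := Structure {
  pres :> prestructure;
  presP : coherent pres }.

(* All derivations of a term have the same interpretation, so [smcP] is the
   condition for every term. *)
Record smor (M N : structure) := SMor {
  smc :> forall a : S, hom (M a) (N a);
  smcP : forall x A t B (d : deriv x A t B),
    tmor smc A >> interp N d = interp M d >> tmor smc B }.

Lemma smorP (M N : structure) (h k : smor M N) :
  (forall a, h a = k a) -> h = k.
Proof.
case: h k => [h hP] [k kP] /= hk.
have e : h = k by apply: functional_extensionality_dep.
by subst k; congr SMor; apply: Prop_irrelevance.
Qed.

Lemma tmor1 (o : S -> C) A : tmor (fun a => idm (o a)) A = idm (tobj o A).
Proof. by elim: A => //= a A ->; rewrite tensm1. Qed.

Lemma tmorM (o o' o'' : S -> C) (h : forall a, hom (o a) (o' a))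
    (k : forall a, hom (o' a) (o'' a)) A :
  tmor (fun a => h a >> k a) A = tmor h A >> tmor k A.
Proof. by elim: A => [|a A /= ->] /=; rewrite ?comp1m ?tensmM. Qed.

Lemma smor_id_subproof (M : structure) x A t B (d : deriv x A t B) :
  tmor (fun a => idm (M a)) A >> interp M d =
  interp M d >> tmor (fun a => idm (M a)) B.
Proof. by rewrite !tmor1 comp1m compm1. Qed.

Definition smor_id (M : structure) : smor M M := SMor (@smor_id_subproof M).

Lemma smor_comp_subproof (M N P : structure) (h : smor M N) (k : smor N P)
    x A t B (d : deriv x A t B) :
  tmor (fun a => h a >> k a) A >> interp P d =
  interp M d >> tmor (fun a => h a >> k a) B.
Proof. by rewrite !tmorM -compA smcP !compA smcP. Qed.

Definition smor_comp (M N P : structure) (h : smor M N) (k : smor N P) :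
    smor M P :=
  SMor (@smor_comp_subproof M N P h k).

Lemma smor_comp1m M N (h : smor M N) : smor_comp (smor_id M) h = h.
Proof. by apply: smorP => a /=; rewrite comp1m. Qed.

Lemma smor_compm1 M N (h : smor M N) : smor_comp h (smor_id N) = h.
Proof. by apply: smorP => a /=; rewrite compm1. Qed.

Lemma smor_compA M N P Q (h : smor M N) (k : smor N P) (l : smor P Q) :
  smor_comp h (smor_comp k l) = smor_comp (smor_comp h k) l.
Proof. by apply: smorP => a /=; rewrite compA. Qed.

Definition str_cat : category := Category smor_comp1m smor_compm1 smor_compA.

End Structures.

Section Transport.
Variables (L : language) (C D : monoidal) (F : smfunctor C D).
Local Notation S := (sort L).

Definition iso_fmap (a b : C) (u : iso a b) : iso (F a) (F b) :=
  Iso (iso_fmap_subproof F u) (iso_fmap_subproof F (iso_sym u)).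

(* The coherence isomorphism F|A_1| ... F|A_n| -> F(|A_1| ... |A_n|). *)
Fixpoint tphi (o : S -> C) (A : seq S) :
    iso (tobj (fun a => F (o a)) A) (F (tobj o A)) :=
  match A return iso (tobj (fun a => F (o a)) A) (F (tobj o A)) with
  | [::] => phi0 F
  | a :: A' => iso_comp (iso_tens (iso_id (F (o a))) (tphi o A'))
                 (phi2 F (o a) (tobj o A'))
  end.

Definition ptrans (M : prestructure L C) : prestructure L D :=
  @PreStructure L D (fun a => F (M a))
    (fun f => tphi M (dom f) >> fmap F (pop M f))
    (fun w A => tphi M A >> fmap F (pweak M w A) >> bwd (phi0 F))
    (fun w n s A => tphi M (permt s A) >> fmap F (pexch M w s A) >> bwd (tphi M A))
    (fun w A => tphi M A >> fmap F (pcontr M w A) >> bwd (tphi M (A ++ A))).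

(* [sq u v f f'] : f corresponds to F f' through the comparison arrows u, v. *)
Definition sq X X' Y Y' (u : hom X (F X')) (v : hom Y (F Y'))
    (f : hom X Y) (f' : hom X' Y') : Prop := f >> v = u >> fmap F f'.

Definition cmp2 X X' Y Y' (u : hom X (F X')) (v : hom Y (F Y')) :
  hom (X ** Y) (F (X' ** Y')) := (u *** v) >> phi2 F X' Y'.

Lemma sq1 X X' (u : hom X (F X')) : sq u u (idm X) (idm X').
Proof. by rewrite /sq comp1m fmap1 compm1. Qed.

Lemma sq_comp X X' Y Y' Z Z' (u : hom X (F X')) (v : hom Y (F Y'))
    (w : hom Z (F Z')) f f' g g' :
  sq u v f f' -> sq v w g g' -> sq u w (f >> g) (f' >> g').
Proof. by rewrite /sq => e1 e2; rewrite -compA e2 compA e1 fmapM compA. Qed.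

Lemma sq_inv X X' Y Y' (u : hom X (F X')) (v : hom Y (F Y'))
    (f : iso X Y) (f' : iso X' Y') :
  sq u v f f' -> sq v u (bwd f) (bwd f').
Proof.
rewrite /sq => e.
have -> : bwd f >> u = bwd f >> (u >> fmap F f') >> fmap F (bwd f').
  by rewrite -!compA -fmapM fwdK fmap1 compm1.
by rewrite -e compA bwdK comp1m.
Qed.

Lemma sq_tens X X' Y Y' Z Z' W W' (u : hom X (F X')) (v : hom Y (F Y'))
    (w : hom Z (F Z')) (z : hom W (F W')) f f' g g' :
  sq u v f f' -> sq w z g g' -> sq (cmp2 u w) (cmp2 v z) (f *** g) (f' *** g').
Proof.
rewrite /sq /cmp2 => e1 e2.
by rewrite compA -tensmM e1 e2 tensmM -compA phi2N compA.
Qed.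

Lemma sq_asc X X' Y Y' Z Z' (u : hom X (F X')) (v : hom Y (F Y'))
    (w : hom Z (F Z')) :
  sq (cmp2 (cmp2 u v) w) (cmp2 u (cmp2 v w)) (asc X Y Z) (asc X' Y' Z').
Proof.
rewrite /sq /cmp2.
have -> : (u *** v >> phi2 F X' Y') *** w =
    (u *** v *** w) >> (phi2 F X' Y' *** idm (F Z')).
  by rewrite -tensmM compm1.
have -> : u *** (v *** w >> phi2 F Y' Z') =
    (u *** (v *** w)) >> (idm (F X') *** phi2 F Y' Z').
  by rewrite -tensmM compm1.
rewrite -!compA (compA _ (phi2 _ _ _) (fmap _ _)) phi2A.
by rewrite !compA ascN.
Qed.

Lemma sq_lun X X' (u : hom X (F X')) :
  sq (cmp2 (phi0 F) u) u (lun X) (lun X').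
Proof.
rewrite /sq /cmp2 -lunN -phi2l !compA -tensmM.
by rewrite comp1m compm1.
Qed.

Lemma sq_run X X' (u : hom X (F X')) :
  sq (cmp2 u (phi0 F)) u (run X) (run X').
Proof.
rewrite /sq /cmp2 -runN -phi2r !compA -tensmM.
by rewrite comp1m compm1.
Qed.

Lemma tphi_cons (o : S -> C) a A :
  (tphi o (a :: A) : hom _ _) = cmp2 (idm (F (o a))) (tphi o A).
Proof. by []. Qed.

Lemma sq_kap (o : S -> C) A B :
  sq (cmp2 (tphi o A) (tphi o B)) (tphi o (A ++ B))
    (kap (fun a => F (o a)) A B) (kap o A B).
Proof.
elim: A => [|a A IH]; first exact: sq_lun.
apply: (@sq_comp _ _ _ _ _ _ _ (cmp2 (idm (F (o a))) (cmp2 (tphi o A) (tphi o B)))).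
  exact: sq_asc.
by apply: sq_tens IH; apply: sq1.
Qed.

Variable M : prestructure L C.

Lemma sq_conj X X' Y Y' (u : hom X (F X')) (v : iso Y (F Y')) (f : hom X' Y') :
  sq u v (u >> fmap F f >> bwd v) f.
Proof. by rewrite /sq -!compA bwdK compm1. Qed.

Lemma sq_ktens (A B A' B' : seq S) f f' g g' :
  sq (tphi M A) (tphi M B) f f' -> sq (tphi M A') (tphi M B') g g' ->
  sq (tphi M (A ++ A')) (tphi M (B ++ B'))
    (ktens (M := ptrans M) f g) (ktens (M := M) f' g').
Proof.
move=> e1 e2; apply: sq_comp (sq_kap _ _ _).
by apply: sq_comp (sq_tens e1 e2); apply/sq_inv/sq_kap.
Qed.

Lemma interp_ptrans x A t B (d : deriv x A t B) :
  sq (tphi M A) (tphi M B) (interp (ptrans M) d) (interp M d).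
Proof.
move: x A t B d; apply: (@deriv_mut L
  (fun x A t B d => sq (tphi M A) (tphi M B) (interp (ptrans M) d) (interp M d))
  (fun xs As ts Bs ds => sq (tphi M (flatten As)) (tphi M Bs)
    (interps (ptrans M) ds) (interps M ds))) => /=.
- by move=> v B; apply: sq1.
- move=> f xs As ts _ ds IH.
  apply: (@sq_comp _ _ _ _ _ _ _ (idm (F (M (cod f))))).
    by apply: sq_comp IH _; rewrite /sq compm1.
  by apply: sq_inv; apply: sq_run.
- by move=> x A s y B t E d1 IH1 d2 IH2; apply: sq_comp IH1 IH2.
- exact: sq1.
- by move=> x A s B y E t E' _ d1 IH1 d2 IH2; apply: sq_ktens.
- move=> x1 A1 x2 A2 x3 A3 t B w _ _ _ d IH.
  apply: sq_comp IH; apply: sq_ktens; first exact: sq1.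
  apply: sq_comp (sq_lun _).
  apply: sq_comp (sq_tens (sq_conj _ _ _) (sq1 _)).
  exact/sq_inv/sq_kap.
- move=> n s x A t B w d IH.
  by apply: sq_comp IH; apply: sq_conj.
- move=> x1 A1 x x' A x2 A2 t B w _ _ _ d IH.
  apply: sq_comp IH; apply: sq_ktens; first exact: sq1.
  apply: sq_comp (sq_kap _ _ _).
  apply: sq_comp (sq_tens (sq1 _) (sq_kap _ _ _)).
  apply: sq_comp (sq_asc _ _ _).
  apply: sq_comp (sq_tens _ (sq1 _)).
    exact/sq_inv/sq_kap.
  by apply: sq_comp (sq_conj _ _ _) _; apply/sq_inv/sq_kap.
- exact: sq1.
- by move=> x A t B xs As ts Bs d IH ds IHs; apply: (@sq_ktens A [:: B] (flatten As) Bs _ _ _ _ IH IHs).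
Qed.

Lemma ptrans_coherent : coherent M -> coherent (ptrans M).
Proof.
move=> cM x A t B d d'.
have e : interp (ptrans M) d >> tphi M B = interp (ptrans M) d' >> tphi M B.
  by rewrite !interp_ptrans (cM _ _ _ _ d d').
rewrite -[LHS]compm1 -[RHS]compm1 -(fwdK (tphi M B)) !compA.
by rewrite e.
Qed.

End Transport.

Section Evaluation.
Variables (L : language) (C D : monoidal) (M : structure L C).

Definition strans (F : smfunctor C D) : structure L D :=
  Structure (@ptrans_coherent L C D F M (@presP L C M)).

Lemma tmor_mnat (F G : smfunctor C D) (k : mnat F G) A :
  tmor (fun a => k (M a)) A >> tphi G M A = tphi F M A >> k (tobj M A).
Proof.
elim: A => [|a A IH] /=; first by rewrite comp1m mcomp1.
rewrite compA -tensmM IH -compA mcompM compA -tensmM.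
by rewrite compm1 comp1m.
Qed.

Lemma smor_mnat_subproof (F G : smfunctor C D) (k : mnat F G)
    x A t B (d : deriv x A t B) :
  tmor (fun a => k (M a)) A >> interp (strans G) d =
  interp (strans F) d >> tmor (fun a => k (M a)) B.
Proof.
rewrite -[LHS]compm1 -[RHS]compm1 -(fwdK (tphi G M B)) !compA; congr (_ >> _).
rewrite -!compA interp_ptrans tmor_mnat !compA interp_ptrans tmor_mnat.
by rewrite -!compA mcompN.
Qed.

Definition smor_mnat (F G : smfunctor C D) (k : mnat F G) :
    smor (strans F) (strans G) :=
  @SMor L D (strans F) (strans G) (fun a => k (M a)) (smor_mnat_subproof k).

Lemma eval_subproof1 (F : smfunctor C D) :
  smor_mnat (mnat_id F) = smor_id (strans F).
Proof. exact: smorP. Qed.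

Lemma eval_subproof2 (F G H : smfunctor C D) (k : mnat F G) (l : mnat G H) :
  smor_mnat (mnat_comp k l) = smor_comp (smor_mnat k) (smor_mnat l).
Proof. exact: smorP. Qed.

Definition evaluation : functor (hom_cat C D) (str_cat L D) :=
  @Functor (hom_cat C D) (str_cat L D) strans smor_mnat
    eval_subproof1 eval_subproof2.

End Evaluation.

Section Substitution.
Variable L : language.
Local Notation S := (sort L).
Local Notation atom := (atom L).
Local Notation raw := (raw L).

Fixpoint avars (a : atom) : seq nat :=
  match a with
  | Var v => [:: v]
  | App f ts => flatten [seq flatten [seq avars b | b <- t] | t <- ts]
  end.
Definition rvars (t : raw) : seq nat := flatten [seq avars a | a <- t].

Lemma rvars_cat s t : rvars (s ++ t) = rvars s ++ rvars t.
Proof. by rewrite /rvars map_cat flatten_cat. Qed.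

Lemma rvars_vars x : rvars (vars x) = x.
Proof. by rewrite /rvars /vars -map_comp; apply: flatten_seq1. Qed.

Lemma rvars_flatten ts : rvars (flatten ts) = flatten [seq rvars t | t <- ts].
Proof. by elim: ts => //= t ts IH; rewrite rvars_cat IH. Qed.

Lemma rvars_app f ts : rvars [:: App f ts] = rvars (flatten ts).
Proof. by rewrite rvars_flatten /rvars /= cats0. Qed.

Lemma abind_ext (e e' : nat -> atom) a :
  (forall v, v \in avars a -> e v = e' v) -> abind e a = abind e' a.
Proof.
move: a; fix IH 1 => -[v|f ts] /= h; first by apply: h; rewrite mem_seq1.
congr App; elim: ts h => //= t ts IHts h.
congr cons; last by apply: IHts => v hv; apply: h; rewrite mem_cat hv orbT.
have {h} : forall v, v \in flatten [seq avars b | b <- t] -> e v = e' v.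
  by move=> v hv; apply: h; rewrite mem_cat hv.
elim: t {IHts} => //= b t IHt h; congr cons.
  by apply: IH => v hv; apply: h; rewrite mem_cat hv.
by apply: IHt => v hv; apply: h; rewrite mem_cat hv orbT.
Qed.

Lemma abind_abind (e e' : nat -> atom) a :
  abind e (abind e' a) = abind (fun v => abind e (e' v)) a.
Proof.
move: a; fix IH 1 => -[v|f ts] //=.
congr App; elim: ts => //= t ts ->; congr cons.
by elim: t => //= b t ->; rewrite IH.
Qed.

Lemma avars_abind (e : nat -> atom) a :
  avars (abind e a) = flatten [seq avars (e v) | v <- avars a].
Proof.
move: a; fix IH 1 => -[v|f ts] /=; first by rewrite cats0.
elim: ts => //= t ts ->; rewrite map_cat flatten_cat; congr cat.
by elim: t => //= b t ->; rewrite map_cat flatten_cat IH.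
Qed.

Lemma subst_ext x s y s' (t : raw) :
  (forall v, v \in rvars t -> env x s v = env y s' v) ->
  subst x s t = subst y s' t.
Proof.
elim: t => //= a t IH h; congr cons.
  by apply: abind_ext => v hv; apply: h; rewrite /rvars /= mem_cat hv.
by apply: IH => v hv; apply: h; rewrite /rvars /= mem_cat hv orbT.
Qed.

Lemma subst_cat x s (t t' : raw) :
  subst x s (t ++ t') = subst x s t ++ subst x s t'.
Proof. exact: map_cat. Qed.

Lemma size_subst x s (t : raw) : size (subst x s t) = size t.
Proof. exact: size_map. Qed.

Lemma size_vars x : size (vars x : raw) = size x.
Proof. exact: size_map. Qed.

Lemma env_cat x y (s t : raw) v : size s = size x ->
  env (x ++ y) (s ++ t) v = if v \in x then env x s v else env y t v.
Proof.
move=> e; rewrite /env index_cat; case: ifP => hv.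
  by rewrite nth_cat e index_mem hv.
by rewrite nth_cat e ltnNge leq_addr /= addKn.
Qed.

Lemma env_subst x (s : raw) y u v : v \in x -> size s = size x ->
  env x (subst y u s) v = abind (env y u) (env x s v).
Proof.
by move=> hv e; rewrite /env (nth_map (Var v)) // e index_mem.
Qed.

Lemma env_nth x (s : raw) v0 a0 i : uniq x -> size s = size x -> i < size x ->
  env x s (nth v0 x i) = nth a0 s i.
Proof.
move=> ux e hi; rewrite /env index_uniq //.
by apply: set_nth_default; rewrite e.
Qed.

Lemma subst_subst_ext x (s : raw) y u x' s' t :
  (forall v, v \in rvars t -> abind (env x s) (env y u v) = env x' s' v) ->
  subst x s (subst y u t) = subst x' s' t.
Proof.
elim: t => //= a t IH h; congr cons; last first.
  by apply: IH => v hv; apply: h; rewrite /rvars /= mem_cat hv orbT.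
rewrite abind_abind; apply: abind_ext => v hv.
by apply: h; rewrite /rvars /= mem_cat hv.
Qed.

Lemma subst_subst x (s : raw) y u t :
  {subset rvars t <= y} -> size u = size y ->
  subst x s (subst y u t) = subst y (subst x s u) t.
Proof.
by move=> ht e; apply: subst_subst_ext => v /ht hv; rewrite env_subst.
Qed.

Lemma subst_vars x (s : raw) : uniq x -> size s = size x ->
  subst x s (vars x) = s.
Proof.
move=> ux e; apply: (@eq_from_nth _ (Var 0)); rewrite !size_map // => i hi.
rewrite (nth_map (Var 0)) ?size_map // (nth_map 0) //=.
exact: env_nth.
Qed.

Lemma subst_catl x y s u (t : raw) : size s = size x -> {subset rvars t <= x} ->
  subst (x ++ y) (s ++ u) t = subst x s t.
Proof.
by move=> e ht; apply: subst_ext => v /ht hv; rewrite env_cat // hv.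
Qed.

Lemma subst_catr x y s u (t : raw) : size s = size x -> uniq (x ++ y) ->
  {subset rvars t <= y} -> subst (x ++ y) (s ++ u) t = subst y u t.
Proof.
rewrite cat_uniq => e /and3P[_ /hasPn hxy _] ht.
by apply: subst_ext => v /ht /hxy hv; rewrite env_cat // (negbTE hv).
Qed.

Lemma rvars_subst x (s t : raw) v : v \in rvars (subst x s t) ->
  exists2 w, w \in rvars t & v \in avars (env x s w).
Proof.
elim: t => //= a t IH; rewrite /rvars /= mem_cat avars_abind => /orP[].
  case/flatten_mapP => w hw hv; exists w => //.
  by rewrite mem_cat hw.
by case/IH => w hw hv; exists w => //; rewrite mem_cat; apply/orP; right.
Qed.

Lemma avars_env x (s : raw) w : w \in x -> size s = size x ->
  {subset avars (env x s w) <= rvars s}.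
Proof.
move=> hw e v; rewrite /env => hv; apply/flattenP.
set i := index w x in hv *; have hi : i < size s by rewrite e index_mem.
exists (avars (nth (Var w) s i)) => //.
by rewrite -(nth_map _ [::]) // mem_nth // size_map.
Qed.

Definition wf (x : seq nat) (A : seq S) (t : raw) (B : seq S) : Prop :=
  [/\ uniq x, size x = size A, size t = size B & {subset rvars t <= x}].

Definition wfs (xs : seq (seq nat)) (As : seq (seq S)) (ts : seq raw)
    (Bs : seq S) : Prop :=
  [/\ size (flatten xs) = size (flatten As), size ts = size Bs,
      all (fun t => size t == 1) ts &
      {subset rvars (flatten ts) <= flatten xs}].

Lemma mem_permt (T : eqType) n (s : 'S_n) (u : n.-tuple T) : permt s u =i u.
Proof.
move=> v; apply/tnthP/tnthP => -[i ->].
  by exists (s i); rewrite tnth_mktuple.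
by exists ((s^-1)%g i); rewrite tnth_mktuple permKV.
Qed.

Lemma uniq_permt (T : eqType) n (s : 'S_n) (u : n.-tuple T) :
  uniq u -> uniq (permt s u).
Proof.
move/tuple_uniqP => h; apply/tuple_uniqP => i j.
by rewrite !tnth_mktuple => /h /perm_inj.
Qed.

Lemma sub_contr x1 x x' x2 (t : raw) : size x' = size x ->
  {subset rvars t <= x1 ++ x ++ x' ++ x2} ->
  {subset rvars (subst x' (vars x) t) <= x1 ++ x ++ x2}.
Proof.
move=> e ht v /rvars_subst[w /ht hw].
have [hx'|nx'] := boolP (w \in x').
  have : size (vars x : raw) = size x' by rewrite size_vars.
  move=> /(avars_env hx') h /h.
  by rewrite rvars_vars !mem_cat => ->; rewrite orbT.
rewrite /env nth_default ?memNindex ?size_vars ?e //= mem_seq1 => /eqP ->.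
by move: hw; rewrite !mem_cat (negbTE nx').
Qed.

Lemma deriv_wf :
  (forall x A (t : raw) B, deriv x A t B -> wf x A t B) /\
  (forall xs As (ts : seq raw) Bs, derivs xs As ts Bs -> wfs xs As ts Bs).
Proof.
apply: (@derivs_mutind L
  (fun x A t B _ => wf x A t B) (fun xs As ts Bs _ => wfs xs As ts Bs)).
- by move=> v B; split => // w; rewrite /rvars.
- move=> f xs As ts u _ [e _ _ h]; split => // v.
  by rewrite rvars_app => /h.
- move=> x A s y B t E _ [ux ex es hs] _ [uy ey et ht]; split => //.
    by rewrite size_subst.
  move=> v /rvars_subst[w /ht hw hv]; apply: hs.
  by apply: avars_env hv => //; rewrite es ey.
- by split.
- move=> x A s B y E t E' u _ [ux ex es hs] _ [uy ey et ht]; split => //.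
  + by rewrite !size_cat ex ey.
  + by rewrite !size_cat es et.
  + by move=> v; rewrite rvars_cat !mem_cat => /orP[/hs->|/ht->] //; rewrite orbT.
- move=> x1 A1 x2 A2 x3 A3 t B _ e1 e2 u _ [_ e et ht]; split => //.
    by move: e; rewrite !size_cat e1 e2 => /addnI ->.
  by move=> v /ht; rewrite !mem_cat => /orP[->|->]; rewrite ?orbT.
- move=> n s x A t B _ _ [ux _ et ht]; split => //.
  + exact: uniq_permt.
  + by rewrite !size_tuple.
  + by move=> v /ht; rewrite mem_permt.
- move=> x1 A1 x x' A x2 A2 t B _ e1 e e' _ [u ex et ht]; split => //.
  + apply: subseq_uniq u; apply: cat_subseq => //; apply: cat_subseq => //.
    exact: suffix_subseq.
  + by move: ex; rewrite !size_cat e1 e e' => /addnI/addnI/addnI ->.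
  + by rewrite size_subst.
  + by apply: sub_contr ht; rewrite e e'.
- by split.
- move=> x A t B xs As ts Bs _ [ux ex et ht] _ [e1 e2 e3 e4]; split => //=.
  + by rewrite !size_cat ex e1.
  + by rewrite e2.
  + by rewrite et e3.
  + move=> v; rewrite rvars_cat !mem_cat => /orP[/ht->|/e4->] //.
    by rewrite orbT.
Qed.

Lemma derivP x A (t : raw) B : deriv x A t B -> wf x A t B.
Proof. exact: deriv_wf.1. Qed.

Lemma derivsP xs As (ts : seq raw) Bs : derivs xs As ts Bs -> wfs xs As ts Bs.
Proof. exact: deriv_wf.2. Qed.

Lemma derivableP x A (t : raw) B : derivable x A t B -> wf x A t B.
Proof. by case=> /derivP. Qed.

Lemma derivable_id x (A : seq S) : uniq x -> size x = size A ->
  derivable x A (vars x) A.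
Proof.
elim: x A => [|v x IH] [|a A] //=; first by split; apply: d_unit.
move=> /andP[vx ux] [e]; have [d] := IH A ux e.
by split; apply: (@d_tens L [:: v] [:: a] [:: Var v] [:: a] x A) (d_var v a) d; rewrite /= vx.
Qed.

Lemma derivable_subst x A (s : raw) y B t C :
  derivable x A s B -> derivable y B t C -> derivable x A (subst y s t) C.
Proof. by move=> [d] [d']; split; apply: d_subst d d'. Qed.

Lemma derivable_tens x A (s : raw) B y C t D : uniq (x ++ y) ->
  derivable x A s B -> derivable y C t D ->
  derivable (x ++ y) (A ++ C) (s ++ t) (B ++ D).
Proof. by move=> u [d] [d']; split; apply: d_tens. Qed.

Lemma derivable_rename x A (t : raw) B z : uniq z -> size z = size A ->
  derivable x A t B -> derivable z A (subst x (vars z) t) B.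
Proof. by move=> uz ez; apply: derivable_subst; apply: derivable_id. Qed.

End Substitution.

Section TermCategory.
Variable L : language.
Local Notation S := (sort L).
Local Notation raw := (raw L).

Record term (A B : seq S) := Term {
  tctx : seq nat;
  traw : raw;
  termP : derivable tctx A traw B }.

(* The variables z are those of a sequent, hence distinct. *)
Definition alpha (A B : seq S) (s t : term A B) : Prop :=
  exists z : seq nat, [/\ uniq z, size z = size A &
    subst (tctx s) (vars z) (traw s) = subst (tctx t) (vars z) (traw t)].

(* Arrows are the equivalence classes of terms modulo alphabetical variance. *)
Definition tarrow (A B : seq S) : Type :=
  {P : term A B -> Prop | exists t, P = alpha t}.

Definition cls A B (t : term A B) : tarrow A B :=
  exist _ (alpha t) (ex_intro _ t erefl).

Definition repr A B (f : tarrow A B) : term A B := projT1 (cid (proj2_sig f)).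

Lemma reprK A B (f : tarrow A B) : cls (repr f) = f.
Proof.
case: f => P h; rewrite /repr /cls /=; case: cid => t /= e.
by apply: eq_exist.
Qed.

(* The action of a term on the sequences of atomic terms, by substitution. *)
Definition act A B (t : term A B) (zs : raw) : raw :=
  subst (tctx t) zs (traw t).

Lemma term_wf A B (t : term A B) : wf (tctx t) A (traw t) B.
Proof. exact: derivableP (termP t). Qed.

Lemma alphaP A B (s t : term A B) :
  alpha s t <-> (forall zs, size zs = size A -> act s zs = act t zs).
Proof.
split=> [[z [uz ez e]] zs ezs|h]; last first.
  exists (iota 0 (size A)); rewrite iota_uniq size_iota; split=> //.
  by apply: h; rewrite size_vars size_iota.
have [us es _ hs] := term_wf s; have [ut et _ ht] := term_wf t.
have h (u : term A B) : act u zs = subst z zs (act u (vars z)).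
  have [_ eu _ hu] := term_wf u; rewrite /act subst_subst ?subst_vars ?ez //.
  by rewrite size_vars ez.
by rewrite !h /act e.
Qed.

Lemma clsP A B (s t : term A B) : cls s = cls t <-> alpha s t.
Proof.
split=> [[->]|/alphaP h]; first by apply/alphaP.
apply: eq_exist; apply: functional_extensionality_dep => u.
by apply: propositional_extensionality; split=> /alphaP h'; apply/alphaP => zs e;
  rewrite -h' ?h.
Qed.

Definition hact A B (f : tarrow A B) : raw -> raw := act (repr f).

Lemma hact_cls A B (t : term A B) zs : size zs = size A ->
  hact (cls t) zs = act t zs.
Proof. by move: zs; apply/alphaP/clsP/reprK. Qed.

Lemma tarrowP A B (f g : tarrow A B) :
  (forall zs, size zs = size A -> hact f zs = hact g zs) -> f = g.
Proof. by move=> h; rewrite -(reprK f) -(reprK g); apply/clsP/alphaP. Qed.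

Lemma size_hact A B (f : tarrow A B) zs : size (hact f zs) = size B.
Proof. by rewrite size_subst; case: (term_wf (repr f)). Qed.

Definition tcast A B (e : A = B) : term A B :=
  Term (eq_ind A (derivable (iota 0 (size A)) A (vars (iota 0 (size A))))
    (derivable_id (iota_uniq 0 (size A)) (size_iota 0 (size A))) B e).

Definition tcomp A B C (s : term A B) (t : term B C) : term A C :=
  Term (derivable_subst (termP s) (termP t)).

Lemma ttens_subproof A B C D (s : term A B) (t : term C D) :
  derivable (iota 0 (size A) ++ iota (size A) (size C)) (A ++ C)
    (act s (vars (iota 0 (size A))) ++ act t (vars (iota (size A) (size C))))
    (B ++ D).
Proof.
apply: derivable_tens; first by rewrite -iotaD iota_uniq.
  by apply: derivable_rename (termP s); rewrite ?iota_uniq ?size_iota.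
by apply: derivable_rename (termP t); rewrite ?iota_uniq ?size_iota.
Qed.

(* The tensor of two terms, after renaming their variables apart. *)
Definition ttens A B C D (s : term A B) (t : term C D) :
    term (A ++ C) (B ++ D) :=
  Term (ttens_subproof s t).

Definition acast A B (e : A = B) : tarrow A B := cls (tcast e).
Definition acomp A B C (f : tarrow A B) (g : tarrow B C) : tarrow A C :=
  cls (tcomp (repr f) (repr g)).
Definition atens A B C D (f : tarrow A B) (g : tarrow C D) :
    tarrow (A ++ C) (B ++ D) :=
  cls (ttens (repr f) (repr g)).

Lemma hact_cast A B (e : A = B) zs : size zs = size A -> hact (acast e) zs = zs.
Proof.
by move=> ez; rewrite hact_cls // /act /= subst_vars ?iota_uniq ?size_iota.
Qed.

Lemma hact_comp A B C (f : tarrow A B) (g : tarrow B C) zs : size zs = size A ->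
  hact (acomp f g) zs = hact g (hact f zs).
Proof.
move=> ez; rewrite hact_cls // /act /= subst_subst //.
  by case: (term_wf (repr g)).
by case: (term_wf (repr g)) => _ -> _ _; case: (term_wf (repr f)).
Qed.

Lemma hact_tens A B C D (f : tarrow A B) (g : tarrow C D) zs zs' :
  size zs = size A -> size zs' = size C ->
  hact (atens f g) (zs ++ zs') = hact f zs ++ hact g zs'.
Proof.
move=> ez ez'; rewrite hact_cls ?size_cat ?ez ?ez' // /act /=.
have [_ ef _ hf] := term_wf (repr f); have [_ eg _ hg] := term_wf (repr g).
rewrite subst_cat !subst_subst ?size_vars ?size_iota //; congr (_ ++ _).
  congr (subst _ _ _).
  rewrite subst_catl ?subst_vars ?iota_uniq ?size_iota //.
  by rewrite rvars_vars.
congr (subst _ _ _).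
rewrite subst_catr ?subst_vars -?iotaD ?iota_uniq ?size_iota //.
by rewrite rvars_vars.
Qed.

(* The operations on arrows are induced by those on terms. *)
Lemma comp_cls A B C (s : term A B) (t : term B C) :
  acomp (cls s) (cls t) = cls (tcomp s t).
Proof.
apply: tarrowP => zs ez; rewrite hact_comp // !hact_cls //; last first.
  by rewrite size_subst; case: (term_wf s).
rewrite /act /= subst_subst //; first by case: (term_wf t).
by case: (term_wf t) => _ -> _ _; case: (term_wf s).
Qed.

Lemma split_size (A B : seq S) (zs : raw) : size zs = size (A ++ B) ->
  exists z1 z2, [/\ zs = z1 ++ z2, size z1 = size A & size z2 = size B].
Proof.
rewrite size_cat => e; exists (take (size A) zs), (drop (size A) zs).
rewrite cat_take_drop size_drop size_take e addKn; split=> //.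
case: ltnP => // h.
by apply/eqP; rewrite eqn_leq leq_addr andbT.
Qed.

Lemma tens_cls A B C D (s : term A B) (t : term C D) (z z' : seq nat)
    (d : derivable (z ++ z') (A ++ C)
           (act s (vars z) ++ act t (vars z')) (B ++ D)) :
  size z = size A -> size z' = size C -> atens (cls s) (cls t) = cls (Term d).
Proof.
move=> e e'; have [u _ _ _] := derivableP d.
apply: tarrowP => _ /split_size[z1 [z2 [-> e1 e2]]].
rewrite hact_tens // !hact_cls ?size_cat ?e1 ?e2 // /act /= subst_cat.
have [_ es _ hs] := term_wf s; have [_ et _ ht] := term_wf t.
rewrite !subst_subst ?size_vars ?e ?e' //.
have [uz uz'] : uniq z /\ uniq z' by move: u; rewrite cat_uniq => /and3P[].
congr (subst _ _ _ ++ subst _ _ _).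
  by rewrite subst_catl ?subst_vars ?e ?rvars_vars.
by rewrite subst_catr ?subst_vars ?e ?e' ?rvars_vars.
Qed.

Lemma acomp1m A B (f : tarrow A B) : acomp (acast erefl) f = f.
Proof. by apply: tarrowP => zs e; rewrite hact_comp // hact_cast. Qed.

Lemma acompm1 A B (f : tarrow A B) : acomp f (acast erefl) = f.
Proof. by apply: tarrowP => zs e; rewrite hact_comp // hact_cast ?size_hact. Qed.

Lemma acompA A B C D (f : tarrow A B) (g : tarrow B C) (h : tarrow C D) :
  acomp f (acomp g h) = acomp (acomp f g) h.
Proof. by apply: tarrowP => zs e; rewrite !hact_comp ?size_hact. Qed.

Definition term_category : category := Category acomp1m acompm1 acompA.

Lemma acastK A B (e : A = B) : acomp (acast e) (acast (esym e)) = acast erefl.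
Proof.
by apply: tarrowP => zs ez; rewrite hact_comp // !hact_cast // -e.
Qed.

Lemma acastKV A B (e : A = B) : acomp (acast (esym e)) (acast e) = acast erefl.
Proof. by case: _ / e; apply: acomp1m. Qed.

Definition cast_iso (A B : term_category) (e : A = B) : iso A B :=
  @Iso term_category A B (acast e) (acast (esym e)) (acastK e) (acastKV e).

Lemma atens1 A B : atens (acast (erefl A)) (acast (erefl B)) = acast erefl.
Proof.
apply: tarrowP => _ /split_size[z1 [z2 [-> e1 e2]]].
by rewrite hact_tens // !hact_cast // !size_cat e1 e2.
Qed.

Lemma atensM A B C A' B' C' (f : tarrow A B) (g : tarrow B C)
    (f' : tarrow A' B') (g' : tarrow B' C') :
  atens (acomp f g) (acomp f' g') = acomp (atens f f') (atens g g').
Proof.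
apply: tarrowP => _ /split_size[z1 [z2 [-> e1 e2]]].
rewrite hact_tens // !hact_comp ?size_cat ?e1 ?e2 //.
by rewrite !hact_tens ?size_hact.
Qed.

Lemma aascN A A' B B' C C' (f : tarrow A A') (g : tarrow B B')
    (h : tarrow C C') :
  acomp (atens (atens f g) h) (acast (esym (catA A' B' C'))) =
  acomp (acast (esym (catA A B C))) (atens f (atens g h)).
Proof.
apply: tarrowP => _ /split_size[_ [z3 [-> /split_size[z1 [z2 [-> e1 e2]]] e3]]].
rewrite !hact_comp ?hact_cast ?size_hact ?size_cat ?e1 ?e2 ?e3 //.
rewrite -[in RHS](catA z1) !hact_tens ?size_cat ?e1 ?e2 ?e3 //.
by rewrite (catA (hact f z1)).
Qed.

Lemma alunN A B (f : tarrow A B) :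
  acomp (atens (acast (erefl [::])) f) (acast (erefl B)) =
  acomp (acast (erefl A)) f.
Proof.
apply: tarrowP => zs e; rewrite !hact_comp ?hact_cast ?size_hact //.
by rewrite -[zs]cat0s hact_tens // hact_cast.
Qed.

Lemma arunN A B (f : tarrow A B) :
  acomp (atens f (acast (erefl [::]))) (acast (cats0 B)) =
  acomp (acast (cats0 A)) f.
Proof.
apply: tarrowP => _ /split_size[z1 [z2 [-> e1 /size0nil ->]]].
rewrite !hact_comp ?hact_cast ?size_hact ?size_cat ?e1 //.
by rewrite hact_tens // hact_cast // !cats0.
Qed.

Lemma hact_tens_cast A B C D (e : A = B) (e' : C = D) zs :
  size zs = size (A ++ C) -> hact (atens (acast e) (acast e')) zs = zs.
Proof. by move=> /split_size[z1 [z2 [-> e1 e2]]]; rewrite hact_tens // !hact_cast. Qed.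

Lemma atriangle A B :
  acomp (acast (esym (catA A [::] B))) (atens (acast erefl) (acast (erefl B))) =
  atens (acast (cats0 A)) (acast erefl).
Proof.
apply: tarrowP => zs e.
by rewrite hact_comp ?hact_tens_cast ?hact_cast // e -catA.
Qed.

Lemma apentagon A B C D :
  acomp (acast (esym (catA (A ++ B) C D))) (acast (esym (catA A B (C ++ D)))) =
  acomp (acomp (atens (acast (esym (catA A B C))) (acast (erefl D)))
               (acast (esym (catA A (B ++ C) D))))
        (atens (acast (erefl A)) (acast (esym (catA B C D)))).
Proof.
apply: tarrowP => zs e.
by rewrite !hact_comp ?hact_tens_cast ?hact_cast //; rewrite e -!catA.
Qed.

(* The strict monoidal structure given by concatenation; its coherence
   isomorphisms are identity terms. *)
Definition term_cat : monoidal :=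
  @Monoidal term_category [::] cat atens
    (fun A B C => cast_iso (esym (catA A B C)))
    (fun A => cast_iso (erefl A))
    (fun A => cast_iso (cats0 A))
    atens1 atensM aascN alunN arunN atriangle apentagon.

End TermCategory.

Section Generic.
Variable L : language.
Local Notation S := (sort L).
Local Notation raw := (raw L).

Lemma derivable_app (f : op L) x : uniq x -> size x = size (dom f) ->
  derivable x (dom f) [:: App f [seq [:: Var v] | v <- x]] [:: cod f].
Proof.
move=> ux e.
have [ds] : inhabited (derivs (L := L) [seq [:: v] | v <- x]
    [seq [:: b] | b <- dom f] [seq [:: Var v] | v <- x] (dom f)).
  elim: x (dom f) e {ux} => [|v x IH] [|b B] //=; first by split; constructor.
  by case=> /IH[ds]; split; constructor => //; constructor.
split; have := @d_fun L f _ _ _ _ ds.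
by rewrite !flatten_seq1; apply.
Qed.

Lemma derivable_weak x (A : seq S) : has_weak L -> uniq x -> size x = size A ->
  derivable (L := L) x A [::] [::].
Proof.
move=> w ux e; split.
have := @d_weak L [::] [::] x A [::] [::] [::] [::] w erefl e.
by rewrite /= !cats0; apply => //; apply: d_unit.
Qed.

Lemma derivable_exch n (s : 'S_n) (x : n.-tuple nat) (A : n.-tuple S) :
  has_exch L -> uniq x -> derivable (L := L) (permt s x) (permt s A) (vars x) A.
Proof.
move=> w ux; have [|d] := @derivable_id L x A ux; first by rewrite !size_tuple.
by split; apply: d_exch.
Qed.

Lemma derivable_contr x (A : seq S) : has_contr L -> uniq x -> size x = size A ->
  derivable (L := L) x A (vars x ++ vars x) (A ++ A).
Proof.
move=> w ux e.
pose x' := iota (\sum_(v <- x) v.+1) (size A).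
have hx : {in x, forall v, v \notin x'}.
  move=> v hv; rewrite mem_iota (big_rem v) //= negb_and -ltnNge.
  by rewrite addSn ltnS leq_addr.
have ux' : uniq (x ++ x').
  rewrite cat_uniq ux iota_uniq andbT; apply/hasPn => v hv.
  by apply: contraL hv => /hx.
have [|d] := @derivable_id L (x ++ x') (A ++ A) ux'.
  by rewrite !size_cat size_iota e.
split; have := @d_contr L [::] [::] x x' A [::] [::] (vars (x ++ x')) (A ++ A) w
  erefl e (size_iota _ _).
rewrite /= !cats0 => /(_ d).
rewrite /vars map_cat subst_cat subst_vars ?iota_uniq ?size_vars ?size_iota //.
rewrite -/(vars x) (_ : subst x' (vars x) (vars x) = vars x) //.
rewrite /subst /vars -map_comp; apply/eq_in_map => v /hx hv /=.
by rewrite /env nth_default // memNindex // size_map size_iota e.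
Qed.

Definition gobj (a : S) : term_cat L := [:: a].

Lemma tobj_gobj (A : seq S) : tobj gobj A = A.
Proof. by elim: A => //= a A ->. Qed.

Lemma derivable_gobj x (A : seq S) (t : raw) B : derivable x A t B ->
  derivable x (tobj gobj A) t (tobj gobj B).
Proof. by rewrite !tobj_gobj. Qed.

(* The arrow |A| -> |B| given by the term x:A |- t:B. *)
Definition garrow x (A : seq S) (t : raw) B (d : derivable x A t B) :
    @hom (term_cat L) (tobj gobj A) (tobj gobj B) :=
  cls (Term (derivable_gobj d)).

Definition gprestructure : prestructure L (term_cat L) :=
  @PreStructure L (term_cat L) gobj
    (fun f => garrow (derivable_app (f := f) (iota_uniq 0 _) (size_iota 0 _)))
    (fun w A => garrow (derivable_weak w (iota_uniq 0 _) (size_iota 0 (size A))))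
    (fun w n s A =>
       garrow (derivable_exch s A w (iota_uniq 0 _ : uniq (iota_tuple n 0))))
    (fun w A => garrow (derivable_contr w (iota_uniq 0 _) (size_iota 0 (size A)))).

Local Notation G := gprestructure.
Lemma hact_compG (A B C : term_cat L) (f : hom A B) (g : hom B C) zs :
  size zs = size A -> hact (f >> g) zs = hact g (hact f zs).
Proof. exact: hact_comp. Qed.

Lemma hact_tensG (A B C D : term_cat L) (f : hom A B) (g : hom C D) zs zs' :
  size zs = size A -> size zs' = size C ->
  hact (f *** g) (zs ++ zs') = hact f zs ++ hact g zs'.
Proof. exact: hact_tens. Qed.

Lemma hact_id (A : term_cat L) zs : size zs = size A -> hact (idm A) zs = zs.
Proof. exact: hact_cast. Qed.

Lemma hact_garrow x (A : seq S) (t : raw) B (d : derivable x A t B) zs :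
  size zs = size A -> hact (garrow d) zs = subst x zs t.
Proof. by move=> e; rewrite hact_cls // tobj_gobj. Qed.

Lemma hact_inv (A B : term_cat L) (u : iso A B) :
  size A = size B ->
  (forall zs, size zs = size A -> hact (fwd u) zs = zs) ->
  forall zs, size zs = size A -> hact (bwd u) zs = zs.
Proof.
move=> eAB h zs e; rewrite -{1}(h zs e) -hact_compG // fwdK.
exact: hact_id.
Qed.

Lemma size_gobj A : size (tobj gobj A) = size A.
Proof. by rewrite tobj_gobj. Qed.

Lemma size_tens (A B : term_cat L) : size (A ** B) = size A + size B.
Proof. exact: size_cat. Qed.

Lemma hact_kap A B zs : size zs = size (A ++ B) -> hact (fwd (kap gobj A B)) zs = zs.
Proof.
elim: A zs => [|a A IH] zs e.
  by apply: hact_cast; rewrite e; apply: esym (size_gobj B).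
have e' : size zs = size ((gobj a ** tobj gobj A) ** tobj gobj B).
  by rewrite e !size_tens !size_gobj !size_cat.
have -> : fwd (kap gobj (a :: A) B) =
  asc (gobj a) (tobj gobj A) (tobj gobj B) >> (idm (gobj a) *** kap gobj A B) by [].
rewrite hact_compG // [X in hact _ X]hact_cast //.
case: zs e {e'} => // z zs [e]; rewrite -[z :: zs]/([:: z] ++ zs).
rewrite hact_tensG //; last by rewrite size_tens !size_gobj e size_cat.
by rewrite hact_id // IH.
Qed.

Lemma hact_kapV A B zs : size zs = size (A ++ B) ->
  hact (bwd (kap gobj A B)) zs = zs.
Proof.
move=> e; apply: hact_inv; rewrite ?size_tens ?size_gobj ?size_cat //.
- by move=> ws e'; apply: hact_kap; rewrite e' size_cat.
- by rewrite e size_cat.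
Qed.

Lemma hact_ktens (A B A' B' : seq S) (f : hom (tobj G A) (tobj G B))
    (g : hom (tobj G A') (tobj G B')) zs zs' :
  size zs = size A -> size zs' = size A' ->
  hact (ktens (M := G) f g) (zs ++ zs') = hact f zs ++ hact g zs'.
Proof.
move=> e e'; rewrite /ktens !hact_compG ?size_tens ?size_gobj ?size_cat ?e ?e' //.
rewrite hact_kapV ?size_cat ?e ?e' // hact_tensG ?size_gobj //.
by rewrite hact_kap // !size_cat !size_hact !size_gobj.
Qed.

Lemma hact_pop f zs : size zs = size (dom f) ->
  hact (pop G f) zs = [:: App f [seq [:: a] | a <- zs]].
Proof.
move=> e; pose d := derivable_app (f := f) (iota_uniq 0 _) (size_iota 0 _).
rewrite -[LHS]/(hact (garrow d) zs) hact_garrow // /subst /=; congr [:: App f _].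
rewrite -[in RHS](@subst_vars L (iota 0 (size (dom f))) zs) ?iota_uniq ?size_iota //.
by rewrite /subst /vars -!map_comp.
Qed.

Lemma hact_pweak w A zs : size zs = size A -> hact (pweak G w A) zs = [::].
Proof.
move=> e; pose d := derivable_weak w (iota_uniq 0 _) (size_iota 0 (size A)).
by rewrite -[LHS]/(hact (garrow d) zs) hact_garrow.
Qed.

Lemma hact_pexch w n (s : 'S_n) (A : n.-tuple S) zs : size zs = n ->
  hact (pexch G w s A) zs =
  subst (permt s (iota_tuple n 0)) zs (vars (iota_tuple n 0)).
Proof.
move=> e; pose d :=
  derivable_exch s A w (iota_uniq 0 _ : uniq (iota_tuple n 0)).
by rewrite -[LHS]/(hact (garrow d) zs) hact_garrow ?size_tuple.
Qed.

Lemma hact_pcontr w A zs : size zs = size A -> hact (pcontr G w A) zs = zs ++ zs.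
Proof.
move=> e.
pose d := derivable_contr w (iota_uniq 0 _) (size_iota 0 (size A)).
rewrite -[LHS]/(hact (garrow d) zs) hact_garrow // subst_cat.
by rewrite !subst_vars ?iota_uniq ?size_iota.
Qed.

Lemma hact_iweak w A1 A A2 zs1 zs zs2 :
  size zs1 = size A1 -> size zs = size A -> size zs2 = size A2 ->
  hact (iweak G w A1 A A2) (zs1 ++ zs ++ zs2) = zs1 ++ zs2.
Proof.
move=> e1 e e2; rewrite hact_ktens ?size_cat ?e ?e2 //.
rewrite hact_id ?size_gobj //; congr (_ ++ _).
rewrite !hact_compG ?size_tens ?size_gobj ?size_cat ?e ?e2 //.
rewrite hact_kapV ?size_cat ?e ?e2 // hact_tensG ?size_gobj //.
rewrite hact_id ?size_gobj // hact_pweak //.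
by apply: hact_cast; rewrite size_gobj.
Qed.

Lemma hact_icontr w A1 A A2 zs1 zs zs2 :
  size zs1 = size A1 -> size zs = size A -> size zs2 = size A2 ->
  hact (icontr G w A1 A A2) (zs1 ++ zs ++ zs2) = zs1 ++ zs ++ zs ++ zs2.
Proof.
move=> e1 e e2; rewrite hact_ktens ?size_cat ?e ?e2 //.
rewrite hact_id ?size_gobj //; congr (_ ++ _).
rewrite !hact_compG ?size_tens ?size_gobj ?size_cat ?e ?e2 //.
rewrite hact_kapV ?size_cat ?e ?e2 // hact_tensG ?size_gobj //.
rewrite hact_compG ?size_gobj // hact_pcontr // hact_kapV ?size_cat ?e //.
rewrite hact_id ?size_gobj // [X in hact _ (hact _ X)]hact_cast; last first.
  by rewrite !size_tens !size_gobj !size_cat e e2.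
rewrite -catA hact_tensG ?size_tens ?size_cat ?size_gobj ?e ?e2 //.
rewrite hact_id ?size_gobj // !hact_kap ?size_cat ?e ?e2 //.
Qed.

Lemma subst_contr x1 x x' x2 (z1 z z2 t : raw) :
  uniq (x1 ++ x ++ x' ++ x2) -> {subset rvars t <= x1 ++ x ++ x' ++ x2} ->
  size z1 = size x1 -> size z = size x -> size x' = size x ->
  subst (x1 ++ x ++ x' ++ x2) (z1 ++ z ++ z ++ z2) t =
  subst (x1 ++ x ++ x2) (z1 ++ z ++ z2) (subst x' (vars x) t).
Proof.
move=> u ht e1 e e'; apply/esym/subst_subst_ext => v /ht.
move: u; rewrite !cat_uniq.
case/and3P=> _ /hasPn d1 /and3P[ux /hasPn d2 /and3P[ux' /hasPn d3 _]] hv.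
have [vx'|nx'] := boolP (v \in x').
  have lt : index v x' < size x by rewrite -e' index_mem.
  have wx : nth 0 x (index v x') \in x by rewrite mem_nth.
  have nw : nth 0 x (index v x') \notin x1 by apply: d1; rewrite mem_cat wx.
  have n1 : v \notin x1 by apply: d1; rewrite !mem_cat vx' orbT.
  have n2 : v \notin x by apply: d2; rewrite mem_cat vx'.
  rewrite [env x' _ v]/env (nth_map 0) //=.
  rewrite !env_cat ?e ?e' // (negbTE n1) (negbTE n2) vx' (negbTE nw) wx.
  rewrite (env_nth _ (Var 0)) //.
  by apply: set_nth_default; rewrite e.
rewrite [env x' _ v]/env nth_default ?memNindex ?size_vars ?e' //=.
by rewrite !env_cat ?e ?e' // (negbTE nx').
Qed.

Lemma hact_interp x A t B (d : deriv x A t B) zs : size zs = size A ->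
  hact (interp G d) zs = subst x zs t.
Proof.
move: x A t B d zs; apply: (@deriv_mut L
  (fun x A t B d => forall zs, size zs = size A ->
     hact (interp G d) zs = subst x zs t)
  (fun xs As ts Bs ds => uniq (flatten xs) ->
     forall zs, size zs = size (flatten As) ->
     hact (interps G ds) zs = subst (flatten xs) zs (flatten ts))).
- move=> v B zs e.
  by rewrite hact_id // -[[:: Var v]]/(vars [:: v]) subst_vars.
- move=> f xs As ts u ds IH zs e; rewrite /= !hact_compG ?size_gobj //.
  have [_ e2 all1 _] := derivsP ds.
  have e3 : size (flatten ts) = size (dom f).
    rewrite -e2; elim: (ts) all1 => //= t ts' IHt /andP[/eqP e1 /IHt e3].
    by rewrite size_cat e1 e3.
  rewrite IH // hact_pop ?size_subst // hact_cast //; congr [:: App f _].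
  elim: (ts) all1 => //= t ts' IHt /andP[].
  by case: t => [|a []] //= _ /IHt ->.
- move=> x A s y B t E d1 IH1 d2 IH2 zs e.
  have [_ es ez hs] := derivP d1; have [_ et _ ht] := derivP d2.
  rewrite /= hact_compG ?size_gobj // IH1 // IH2 ?size_subst //.
  by rewrite subst_subst // ez.
- by case=> // _; apply: hact_id.
- move=> x A s B y E t E' u d1 IH1 d2 IH2 _ /split_size[z1 [z2 [-> e1 e2]]].
  have [_ ex _ hs] := derivP d1; have [_ ey _ ht] := derivP d2.
  rewrite hact_ktens // IH1 // IH2 // subst_cat.
  by rewrite subst_catl ?subst_catr ?e1 ?ex.
- move=> x1 A1 x2 A2 x3 A3 t B w a1 a2 u d IH.
  move=> _ /split_size[z1 [_ [-> e1 /split_size[z2 [z3 [-> e2 e3]]]]]].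
  rewrite /= hact_compG ?size_gobj ?size_cat ?e1 ?e2 ?e3 //.
  rewrite hact_iweak // IH ?size_cat ?e1 ?e3 //.
  have [_ _ _ ht] := derivP d; apply: subst_ext => v /ht.
  rewrite mem_cat !env_cat ?e1 ?e2 //; case: ifP => //= _ hv.
  suff /negbTE -> : v \notin x2 by [].
  move: u; rewrite catA cat_uniq => /and3P[_ /hasPn/(_ v hv)].
  by rewrite mem_cat negb_or => /andP[].
- move=> n s x A t B w d IH zs e; have [ux _ _ ht] := derivP d.
  rewrite size_tuple in e.
  rewrite -[interp G _]/(pexch G w s A >> interp G d).
  rewrite hact_compG ?size_gobj ?size_tuple // hact_pexch //.
  rewrite IH ?size_subst ?size_vars ?size_iota ?size_tuple //.
  apply: subst_ext => v /ht /tnthP[i ->{v}].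
  have envt (y : n.-tuple nat) (us : raw) j : uniq y -> size us = n ->
      env y us (tnth y j) = nth (Var 0) us j.
    by move=> uy eu; rewrite (tnth_nth 0) (env_nth _ (Var 0)) ?size_tuple.
  rewrite envt ?size_subst ?size_vars ?size_iota // -[i](permKV s).
  set j := (s^-1)%g i.
  rewrite -[tnth x (s j)](tnth_mktuple (fun k => tnth x (s k))).
  rewrite -/(permt s x) envt ?uniq_permt //.
  rewrite (nth_map (Var 0)) ?size_vars ?size_iota // (nth_map 0) ?size_iota //=.
  have -> : nth 0 (iota 0 n) (s j) = tnth (permt s (iota_tuple n 0)) j.
    by rewrite tnth_mktuple (tnth_nth 0).
  by apply: envt => //; apply: uniq_permt; apply: iota_uniq.
- move=> x1 A1 x x' A x2 A2 t B w a1 a a' d IH.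
  move=> _ /split_size[z1 [_ [-> e1 /split_size[z [z2 [-> e e2]]]]]].
  rewrite /= hact_compG ?size_gobj ?size_cat ?e1 ?e ?e2 //.
  rewrite hact_icontr // IH ?size_cat ?e1 ?e ?e2 //.
  have [u _ _ ht] := derivP d.
  have [_ ex _ _] := derivP (d_contr w a1 a a' d).
  apply: subst_contr => //; first by rewrite e1.
  - by rewrite e.
  - by rewrite a.
- by move=> _ [] // _; apply: hact_id.
- move=> x A t B xs As ts Bs d IH ds IHs u.
  move=> _ /split_size[z1 [z2 [-> e1 e2]]].
  have [_ ex _ ht] := derivP d.
  have us : uniq (flatten xs) by move: u; rewrite cat_uniq => /and3P[].
  have -> : interps G (ds_cons d ds) = @ktens L _ G A [:: B] (flatten As) Bs
    (interp G d) (interps G ds) by [].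
  rewrite (hact_ktens (B := [:: B])) // IH // IHs // [RHS]subst_cat.
  have [_ _ _ hs] := derivsP ds.
  by rewrite subst_catl ?subst_catr ?e1 ?ex.
Qed.

Lemma gprestructure_coherent : coherent G.
Proof.
move=> x A t B d d'; apply: tarrowP => zs; rewrite size_gobj => e.
by rewrite !hact_interp.
Qed.

Definition generic : structure L (term_cat L) := Structure gprestructure_coherent.

End Generic.

(* Main.v *)
(* A structure M extends to a strong monoidal functor F_M on the term category
   by sending a term to its interpretation: alphabetical variants agree since
   renaming is substitution of variables, which are interpreted by identities.
   Evaluating F_M at the generic structure gives M back up to the unit
   isomorphisms M a ** one -> M a, because the generic structure interprets a
   term by itself.  Conversely a strong monoidal functor F agrees with the
   functor of F G up to the coherence isomorphisms F[a_1] ... F[a_n] -> F A. *)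
From mathcomp Require Import all_boot.
From mathcomp Require Import boolp.
Require Import Defs.

Set Implicit Arguments.
Unset Strict Implicit.
Unset Printing Implicit Defensive.
Local Open Scope cat_scope.

(** * Coherence of the isomorphisms [kap] *)

Section Coherence.
Variable C : monoidal.

Lemma iso_epi (D : category) (a b c : D) (u : iso a b) (f g : hom b c) :
  u >> f = u >> g -> f = g.
Proof. by move=> e; rewrite -[f]comp1m -[g]comp1m -(bwdK u) -!compA e. Qed.

Lemma iso_mono (D : category) (a b c : D) (u : iso b c) (f g : hom a b) :
  f >> u = g >> u -> f = g.
Proof. by move=> e; rewrite -[f]compm1 -[g]compm1 -(fwdK u) !compA e. Qed.

Lemma tens1M (a b c d : C) (f : hom b c) (g : hom c d) :
  idm a *** (f >> g) = (idm a *** f) >> (idm a *** g).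
Proof. by rewrite -tensmM comp1m. Qed.

Lemma tensM1 (a b c d : C) (f : hom b c) (g : hom c d) :
  (f >> g) *** idm a = (f *** idm a) >> (g *** idm a).
Proof. by rewrite -tensmM comp1m. Qed.

Lemma tens1_inj (a b : C) (f g : hom a b) :
  idm one *** f = idm one *** g -> f = g.
Proof. by move=> e; apply: (@iso_epi _ _ _ _ (lun a)); rewrite -!lunN e. Qed.

Lemma tensr1_inj (a b : C) (f g : hom a b) :
  f *** idm one = g *** idm one -> f = g.
Proof. by move=> e; apply: (@iso_epi _ _ _ _ (run a)); rewrite -!runN e. Qed.

(* The three unit coherences below are Kelly's consequences of the triangle
   and the pentagon. *)
Lemma asc_lun (b c : C) : asc one b c >> lun (b ** c) = lun b *** idm c.
Proof.
apply: tens1_inj; apply: (@iso_epi _ _ _ _ (asc one (one ** b) c)).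
apply: (@iso_epi _ _ _ _ (iso_tens (asc one one b) (iso_id c))) => /=.
rewrite tens1M !compA -pentagon -!compA triangle -tensm1 -ascN.
by rewrite -triangle tensM1 -compA ascN.
Qed.

Lemma asc_run (a b : C) : asc a b one >> (idm a *** run b) = run (a ** b).
Proof.
apply: tensr1_inj; apply: (@iso_mono _ _ _ _ (asc a b one)).
rewrite -[in RHS]triangle -[idm (a ** b)]tensm1 -compA ascN compA pentagon.
by rewrite -!compA -tens1M triangle -ascN tensM1 compA.
Qed.

Lemma lun_run1 : fwd (lun (one : C)) = run one.
Proof.
apply: tens1_inj; apply: (@iso_epi _ _ _ _ (asc one one one)).
rewrite triangle asc_run.
by apply: (@iso_mono _ _ _ _ (run one)); rewrite runN.
Qed.

Variables (S : Type) (o : S -> C).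

(** Associativity and right unit of concatenation are only propositional equalities, so the term
    category has casts as coherence arrows; this arrow will interpret such a cast. *)
Definition tcst (A B : seq S) (e : A = B) : hom (tobj o A) (tobj o B) :=
  ecast B (hom (tobj o A) (tobj o B)) e (idm (tobj o A)).

Lemma tcst1 A (e : A = A) : tcst e = idm (tobj o A).
Proof. by rewrite (Prop_irrelevance e erefl). Qed.

(** The two equality proofs are unrelated, so that an induction on types can peel off the head
    whatever proof occurs in the goal. *)
Lemma tcst_cons a A B (e : A = B) (e' : a :: A = a :: B) :
  tcst e' = idm (o a) *** tcst e.
Proof. by case: B / e e' => e'; rewrite !tcst1 tensm1. Qed.

(** This becomes the associativity axiom of the induced functor. The induction starts from
    [asc_lun]; its step is the pentagon, once naturality has moved [asc]. *)
Lemma kapA A B D :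
  (kap o A B *** idm (tobj o D)) >> kap o (A ++ B) D >> tcst (esym (catA A B D)) =
  asc (tobj o A) (tobj o B) (tobj o D) >> (idm (tobj o A) *** kap o B D)
    >> kap o A (B ++ D).
Proof.
elim: A => [|a A IH] /=.
  by rewrite tcst1 compm1 -compA lunN compA asc_lun.
rewrite (tcst_cons (esym (catA A B D))) tensM1 -!compA.
rewrite (compA (idm _ *** kap o A B *** _)) ascN -!compA -!tens1M.
rewrite (compA (kap o A B *** _)) IH !tens1M -[idm (o a ** _)]tensm1.
by rewrite (compA (idm _ *** idm _ *** _)) ascN !compA pentagon.
Qed.

Lemma kaps0 A : kap o A [::] >> tcst (cats0 A) = run (tobj o A).
Proof.
elim: A => [|a A IH] /=; first by rewrite tcst1 compm1 lun_run1.
by rewrite (tcst_cons (cats0 A)) -compA -tens1M IH asc_run.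
Qed.

Lemma eq_tmor (o' : S -> C) (h k : forall a, hom (o a) (o' a)) A :
  (forall a, h a = k a) -> tmor h A = tmor k A.
Proof. by move=> hk; elim: A => //= a A ->; rewrite hk. Qed.

Lemma kap_tmor (o' : S -> C) (h : forall a, hom (o a) (o' a)) A B :
  (tmor h A *** tmor h B) >> kap o' A B = kap o A B >> tmor h (A ++ B).
Proof.
elim: A => [|a A IH] /=; first exact: lunN.
by rewrite compA ascN -!compA -!tensmM comp1m compm1 IH.
Qed.

End Coherence.

(** * The strong monoidal functor induced by a structure *)

Section Interpretation.
Variables (L : language) (C : monoidal) (M : structure L C).
Local Notation S := (sort L).
Local Notation ob := (tobj M).

Lemma ktens1 A B : ktens (M := M) (idm (ob A)) (idm (ob B)) = idm (ob (A ++ B)).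
Proof. by rewrite /ktens tensm1 compm1 bwdK. Qed.

Lemma ktensE A B A' B' (f : hom (ob A) (ob B)) (g : hom (ob A') (ob B')) :
  (f *** g) >> kap M B B' = kap M A A' >> ktens (M := M) f g.
Proof. by rewrite /ktens !compA fwdK comp1m. Qed.

Lemma interp_eq x A t t' B (d : deriv x A t B) (d' : deriv x A t' B) :
  t = t' -> interp M d = interp M d'.
Proof. by move=> e; case: t' / e d' => d'; apply: presP. Qed.

Lemma interp_vars x A : uniq x -> size x = size A ->
  exists d : deriv x A (vars x) A, interp M d = idm (ob A).
Proof.
elim: x A => [|v x IH] [|a A] //=; first by exists d_unit.
move=> /andP[vx ux] [e]; have [d dE] := IH A ux e.
have u : uniq ([:: v] ++ x) by rewrite /= vx.
by exists (d_tens u (d_var v a) d); rewrite /= dE (@ktens1 [:: a] A).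
Qed.

(** An existential is the form from which [cid] can choose a derivation. *)
Lemma derivable_ex x A (t : raw L) B :
  derivable x A t B -> exists _ : deriv x A t B, True.
Proof. by case=> d; exists d. Qed.

Definition tinterp A B (f : tarrow A B) : hom (ob A) (ob B) :=
  interp M (projT1 (cid (derivable_ex (termP (repr f))))).

Lemma tinterp_cls A B (t : term A B) (d : deriv (tctx t) A (traw t) B) :
  tinterp (cls t) = interp M d.
Proof.
rewrite /tinterp; set d' := projT1 _.
have /clsP[z [uz ez e]] := reprK (cls t).
have [dz dzE] := interp_vars uz ez.
(* Precomposed with this identity, both sides interpret [d_subst] derivations, whose raw terms agree
   by [e]. *)
rewrite -[LHS]comp1m -[RHS]comp1m -dzE.
exact: (interp_eq (d_subst dz d') (d_subst dz d)).
Qed.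

Lemma tinterp_repr A B (f : tarrow A B)
    (d : deriv (tctx (repr f)) A (traw (repr f)) B) :
  tinterp f = interp M d.
Proof. exact: presP. Qed.

Lemma repr_deriv A B (f : tarrow A B) :
  exists d : deriv (tctx (repr f)) A (traw (repr f)) B, tinterp f = interp M d.
Proof. by case: (termP (repr f)) => d; exists d; apply: tinterp_repr. Qed.

Lemma tinterp_cast A B (e : A = B) : tinterp (acast e) = tcst M e.
Proof.
case: B / e; rewrite tcst1.
have [d dE] := interp_vars (iota_uniq 0 (size A)) (size_iota 0 (size A)).
by rewrite (@tinterp_cls _ _ (tcast erefl) d).
Qed.

Lemma tinterp_comp A B D (f : tarrow A B) (g : tarrow B D) :
  tinterp (acomp f g) = tinterp f >> tinterp g.
Proof.
have [[d ->] [d' ->]] := (repr_deriv f, repr_deriv g).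
exact: (@tinterp_cls _ _ (tcomp _ _) (d_subst d d')).
Qed.

Lemma tinterp_tens A B A' B' (f : tarrow A B) (g : tarrow A' B') :
  tinterp (atens f g) = ktens (M := M) (tinterp f) (tinterp g).
Proof.
have [[d ->] [d' ->]] := (repr_deriv f, repr_deriv g).
(* [ttens] renames its factors to two disjoint blocks of variables; substituting these identities
   performs the renaming. *)
have [dz dzE] := interp_vars (iota_uniq 0 (size A)) (size_iota 0 (size A)).
have [dz' dzE'] :=
  interp_vars (iota_uniq (size A) (size A')) (size_iota _ (size A')).
have u : uniq (iota 0 (size A) ++ iota (size A) (size A')).
  by rewrite -iotaD iota_uniq.
rewrite (@tinterp_cls _ _ (ttens _ _) (d_tens u (d_subst dz d) (d_subst dz' d'))).
by rewrite /= dzE dzE' !comp1m.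
Qed.

Definition ifunctor : functor (term_cat L) C :=
  @Functor (term_cat L) C ob tinterp
    (fun A => tinterp_cast erefl) tinterp_comp.

Definition ismfunctor : smfunctor (term_cat L) C.
Proof.
apply: (@SMFunctor (term_cat L) C ifunctor (iso_id one) (kap M)).
- by move=> A A' B B' f g; rewrite ktensE -tinterp_tens.
- by move=> A B D; rewrite -[RHS]kapA -tinterp_cast.
- by move=> A; rewrite tensm1 comp1m [fmap _ _]tinterp_cast tcst1 compm1.
- by move=> A; rewrite tensm1 comp1m [fmap _ _]tinterp_cast kaps0.
Defined.

End Interpretation.

(** * Functoriality of the extension *)

Section Extension.
Variables (L : language) (C : monoidal).
Local Notation S := (sort L).
Local Notation G := (gprestructure L).

Definition mnat_smor (M N : structure L C) (h : smor M N) :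
  mnat (ismfunctor M) (ismfunctor N).
Proof.
apply: (@MNat _ _ (ismfunctor M) (ismfunctor N) (tmor h)).
- move=> A B f /=; have [d fE] := repr_deriv M f.
  by rewrite fE (tinterp_repr _ d) smcP.
- exact: comp1m.
- by move=> A B; rewrite /= kap_tmor.
Defined.

Lemma mnat_smor1 (M : structure L C) :
  mnat_smor (smor_id M) = mnat_id (ismfunctor M).
Proof. by apply: mnatP => A /=; rewrite tmor1. Qed.

Lemma mnat_smorM (M N P : structure L C) (h : smor M N) (k : smor N P) :
  mnat_smor (smor_comp h k) = mnat_comp (mnat_smor h) (mnat_smor k).
Proof. by apply: mnatP => A /=; rewrite tmorM. Qed.

Definition extension : functor (str_cat L C) (hom_cat (term_cat L) C) :=
  @Functor (str_cat L C) (hom_cat (term_cat L) C) (@ismfunctor L C) mnat_smor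
    mnat_smor1 mnat_smorM.

(** * Comparison with a given strong monoidal functor *)

Lemma size_generic (A : seq S) : size (tobj G A) = size A.
Proof. exact: size_gobj. Qed.

Definition gcst (A : seq S) : iso (tobj G A : term_cat L) A :=
  @cast_iso L _ _ (tobj_gobj A).

(** Arrows are determined by their action on sequences of atomic terms: casts act trivially there,
    and [hact_interp] gives substitution into [t]. *)
Lemma gcst_interp x A t B (d : deriv x A t B) :
  interp G d >> gcst B = gcst A >> cls (Term (inhabits d)).
Proof.
apply: tarrowP => zs e; have eA : size zs = size A by rewrite e size_generic.
have [_ _ et _] := derivP d.
rewrite !hact_compG // hact_interp // hact_cast; last first.
  by rewrite size_subst et -size_generic.
by rewrite [X in hact _ X]hact_cast // hact_cls.
Qed.

Lemma gcst_kap (A B : seq S) :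
  kap G A B >> gcst (A ++ B) = (gcst A : hom _ _) *** gcst B.
Proof.
apply: tarrowP => zs e.
have eAB : size zs = size (A ++ B) by rewrite e size_tens !size_generic size_cat.
rewrite hact_compG // hact_kap // hact_cast; last by rewrite size_generic.
by rewrite hact_tens_cast.
Qed.

Definition counit (F : smfunctor (term_cat L) C) (A : seq S) :
    iso (tobj (fun a => F [:: a]) A) (F A) :=
  iso_comp (tphi F G A) (iso_fmap F (gcst A)).

(** [interp_ptrans] trades the interpretation in the transported structure for [F] of the generic
    one, which [gcst_interp] identifies with the term. *)
Lemma counitN (F : smfunctor (term_cat L) C) (A B : seq S) (f : tarrow A B) :
  tinterp (strans (generic L) F) f >> counit F B = counit F A >> fmap F f.
Proof.
have [d ->] := repr_deriv (strans (generic L) F) f.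
rewrite -[RHS]compA -fmapM.
have := interp_ptrans F G d; rewrite /sq => e.
rewrite [LHS]compA e -compA -fmapM gcst_interp.
congr (_ >> fmap F (_ >> _)); rewrite -[in RHS](reprK f).
(* The two terms differ at most in their proofs of derivability. *)
exact/clsP/alphaP.
Qed.

Lemma counit1 (F : smfunctor (term_cat L) C) :
  idm one >> counit F [::] = phi0 F.
Proof.
rewrite comp1m -[RHS]compm1 -fmap1; congr (_ >> fmap F _).
by congr acast; apply: Prop_irrelevance.
Qed.

Lemma counitM (F : smfunctor (term_cat L) C) (A B : seq S) :
  kap (fun a => F [:: a]) A B >> counit F (A ++ B) =
  (counit F A *** counit F B) >> phi2 F A B.
Proof.
have := sq_kap F (gobj (L := L)) A B; rewrite /sq /cmp2 => e.
rewrite /counit /= compA e tensmM -!compA phi2N -fmapM.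
by have /= -> := gcst_kap A B.
Qed.

Definition counit_mnat (F : smfunctor (term_cat L) C) :
    mnat (ismfunctor (strans (generic L) F)) F :=
  @MNat _ _ (ismfunctor (strans (generic L) F)) F (fun A => counit F A)
    (@counitN F) (counit1 F) (@counitM F).

(** * Componentwise invertibility, and comparison with a given structure *)

(** Each axiom for the inverse components follows from that for [k] by cancelling isomorphisms. The
    equation on [fwd v] keeps the forward arrow known once [v] is chosen. *)
Lemma mnat_iso (D : monoidal) (F F' : smfunctor D C) (k : mnat F F')
    (u : forall A, iso (F A) (F' A)) :
  (forall A, k A = u A) -> exists v : @iso (hom_cat D C) F F', fwd v = k.
Proof.
move=> ku.
have N A B (f : hom A B) : fmap F' f >> bwd (u B) = bwd (u A) >> fmap F f.
  apply: (@iso_epi _ _ _ _ (u A)); apply: (@iso_mono _ _ _ _ (u B)).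
  by rewrite !compA fwdK comp1m -!compA bwdK compm1 -!ku mcompN.
have N1 : phi0 F' >> bwd (u one) = phi0 F.
  by rewrite -(mcomp1 k) ku -compA fwdK compm1.
have NM A B : phi2 F' A B >> bwd (u (A ** B)) =
    (bwd (u A) *** bwd (u B)) >> phi2 F A B.
  apply: (@iso_epi _ _ _ _ (iso_tens (u A) (u B))) => /=.
  rewrite !compA -tensmM !fwdK tensm1 comp1m -!ku -mcompM ku.
  by rewrite -compA fwdK compm1.
pose k' := MNat N N1 NM.
have kk' : mnat_comp k k' = mnat_id F by apply: mnatP => A /=; rewrite ku fwdK.
have k'k : mnat_comp k' k = mnat_id F' by apply: mnatP => A /=; rewrite ku bwdK.
by exists (@Iso (hom_cat D C) F F' k k' kk' k'k).
Qed.

Lemma smor_iso (M N : structure L C) (h : smor M N)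
    (u : forall a, iso (M a) (N a)) :
  (forall a, h a = u a) -> exists v : @iso (str_cat L C) M N, fwd v = h.
Proof.
move=> hu.
have P x A t B (d : deriv x A t B) :
    tmor (fun a => bwd (u a)) A >> interp M d =
    interp N d >> tmor (fun a => bwd (u a)) B.
  have inv1 E : tmor h E >> tmor (fun a => bwd (u a)) E = idm _.
    rewrite -tmorM -(tmor1 (pobj M)).
    by apply: eq_tmor => a; rewrite hu fwdK.
  have inv2 E : tmor (fun a => bwd (u a)) E >> tmor h E = idm _.
    rewrite -tmorM -(tmor1 (pobj N)).
    by apply: eq_tmor => a; rewrite hu bwdK.
  rewrite -[LHS]compm1 -(inv1 B) -compA (compA (interp M d)) -smcP.
  by rewrite !compA inv2 comp1m.
pose h' := SMor P.
have hh' : smor_comp h h' = smor_id M by apply: smorP => a /=; rewrite hu fwdK.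
have h'h : smor_comp h' h = smor_id N by apply: smorP => a /=; rewrite hu bwdK.
by exists (@Iso (str_cat L C) M N h h' hh' h'h).
Qed.

(** The transported structure has [M a ** one] at [a]. With this formula [unit_smor] follows from
    [interp_ptrans] and [gcst_interp], without a new induction on derivations. *)
Lemma tphi_ismfunctor (M : structure L C) (A : seq S) :
  tphi (ismfunctor M) G A >> fmap (ismfunctor M) (gcst A) =
  tmor (fun a => run (M a)) A.
Proof.
have -> : fmap (ismfunctor M) (gcst A) = tcst M (tobj_gobj A).
  exact: tinterp_cast.
elim: A => [|a A IH]; first by rewrite tcst1 compm1.
rewrite (tcst_cons _ (tobj_gobj A)).
(* Here [phi2] is [kap M [:: a] _], an associator followed by a left unitor, which the triangle
   turns into [run] tensored with an identity. *)
rewrite [LHS](_ : _ = (idm _ *** tphi (ismfunctor M) G A) >> (asc (M a) one _ >>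
  (idm (M a) *** lun _)) >> (idm (M a) *** tcst M (tobj_gobj A))) //.
by rewrite triangle -compA -!tensmM !comp1m compm1 IH.
Qed.

Definition unit_smor (M : structure L C) :
  smor (strans (generic L) (ismfunctor M)) M.
Proof.
apply: (@SMor L C (strans (generic L) (ismfunctor M)) M (fun a => run (M a))).
move=> x A t B d; rewrite -!tphi_ismfunctor.
have := interp_ptrans (ismfunctor M) G d; rewrite /sq => e.
rewrite [RHS]compA e -!compA -fmapM gcst_interp fmapM.
by congr (_ >> (_ >> _)); rewrite /= (tinterp_cls M (t := Term (inhabits d)) d).
Defined.

End Extension.

Theorem theorem4p2 (L : language) (C : monoidal) :
  is_equivalence (evaluation C (generic L) :
    functor (hom_cat (term_cat L) C) (str_cat L C)).
Proof.
exists (extension L C); split.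
  pose w (F : smfunctor (term_cat L) C) :=
    cid (@mnat_iso _ _ _ _ (counit_mnat F) (counit F) (fun A => erefl)).
  exists (fun F => projT1 (w F)) => F F' k.
  rewrite (projT2 (w F)) (projT2 (w F')); apply: mnatP => A /=.
  (* Naturality in [F] splits along [counit]: [tmor_mnat] handles [tphi], and naturality of [k]
     handles the cast. *)
  have /= e := tmor_mnat (generic L) k A.
  by rewrite compA e -!compA mcompN.
pose w (M : structure L C) :=
  cid (@smor_iso _ _ _ _ (unit_smor M) (fun a => run (M a)) (fun a => erefl)).
exists (fun M => projT1 (w M)) => M N h.
rewrite (projT2 (w M)) (projT2 (w N)); apply: smorP => a /=.
(* At [[:: a]] the extension of [h] is [h a *** idm one]. *)
exact: runN.
Qed.
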